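(* Let $R$ be a quasi-fiber product ring with respect to an $R$-regular sequence of length $n\ge 0$. Then the Ext-index of $R$ is at most $n+2$. In particular, every quasi-fiber product ring satisfies the Uniform Auslander Condition (UAC). If, further, $R$ is Gorenstein, then $R$ is an AB ring.
   Context: All local rings are commutative and Noetherian, and all modules are finitely generated. A local ring $(R,\mathfrak m,k)$ is a fiber product ring if $R\cong S\times_k T=\{(s,t)\in S\times T : \pi_S(s)=\pi_T(t)\}$, where $S,T$ are local rings with the same residue field $k$, neither of them equal to $k$, and $\pi_S,\pi_T$ are the reductions modulo the maximal ideals. Equivalently, $\mathfrak m=I\oplus J$ for nonzero ideals $I,J$ of $R$. A local ring $R$ is a quasi-fiber product ring with respect to $\underline x=x_1,\dots,x_n$ ($n\ge 0$) if $\underline x$ is an $R$-regular sequence such that $R/(\underline x)$ is a fiber product ring. Uniform Auslander Condition (UAC) on $R$: there is an integer $b\ge 0$ such that for every pair $M,N$ of $R$-modules, if $\operatorname{Ext}^i_R(M,N)=0$ for all $i\gg 0$, then $\operatorname{Ext}^i_R(M,N)=0$ for all $i\ge b$. The smallest such $b$ is called the Ext-index of $R$. An AB ring is a Gorenstein local ring satisfying (UAC). *)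

(* Defs.v *)
From HB Require Import structures.
From mathcomp Require Import all_boot all_order all_algebra.
From mathcomp Require Import ring_quotient.

Set Implicit Arguments.
Unset Strict Implicit.
Unset Printing Implicit Defensive.

Import GRing.Theory.
Local Open Scope ring_scope.
Local Open Scope quotient_scope.

(** * Noetherian local rings *)

Definition is_ideal (R : comNzRingType) (I : R -> Prop) : Prop :=
  [/\ I 0, forall a b, I a -> I b -> I (a + b) & forall r a, I a -> I (r * a)].

Definition ideal_gen (R : comNzRingType) (xs : seq R) (r : R) : Prop :=
  exists c : 'I_(size xs) -> R, r = \sum_(i < size xs) c i * xs`_i.

Definition noetherian (R : comNzRingType) : Prop :=
  forall I : R -> Prop, is_ideal I ->
    exists xs : seq R, forall r, I r <-> ideal_gen xs r.

Definition maximal_ideal (R : comNzRingType) (I : R -> Prop) : Prop :=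
  [/\ is_ideal I, ~ I 1 &
      forall J : R -> Prop, is_ideal J -> ~ J 1 ->
        (forall r, I r -> J r) -> forall r, J r -> I r].

(* Uniqueness of the maximal ideal is up to extensional equality, since ideals
   are [Prop]-valued predicates. *)
Definition local (R : comNzRingType) : Prop :=
  exists2 m : R -> Prop, maximal_ideal m &
    forall m' : R -> Prop, maximal_ideal m' -> forall r, m' r <-> m r.

Definition local_ring (R : comNzRingType) : Prop := noetherian R /\ local R.

(** * Fiber product rings *)

Definition ring_iso (A B : comNzRingType) : Prop :=
  exists f : {rmorphism A -> B}, bijective f.

Section FiberProduct.
Variables (S T : comNzRingType) (k : fieldType).
Variables (pS : {rmorphism S -> k}) (pT : {rmorphism T -> k}).

Definition fiber_pred : pred (S * T) := fun u => pS u.1 == pT u.2.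

Fact fiber_pred_subring : subring_closed fiber_pred.
Proof.
split=> [|u v|u v]; rewrite !unfold_in /=.
- by rewrite !rmorph1.
- by move=> /eqP eu /eqP ev; rewrite !rmorphB eu ev.
- by move=> /eqP eu /eqP ev; rewrite !rmorphM eu ev.
Qed.

HB.instance Definition _ :=
  GRing.isSubringClosed.Build (S * T)%type fiber_pred fiber_pred_subring.

Definition fiber_product := {u : S * T | fiber_pred u}.

HB.instance Definition _ := SubType.on fiber_product.
HB.instance Definition _ := Choice.on fiber_product.
HB.instance Definition _ :=
  [SubChoice_isSubComNzRing of fiber_product by <:].

End FiberProduct.

(* For a local ring [S] and a field [k], a surjective ring morphism [S -> k] has
   the maximal ideal of [S] as its kernel, so it is the reduction of [S] modulo
   its maximal ideal; [S] equals its residue field iff it is injective. *)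
Definition fiber_product_ring (R : comNzRingType) : Prop :=
  exists (S T : comNzRingType) (k : fieldType)
         (pS : {rmorphism S -> k}) (pT : {rmorphism T -> k}),
  [/\ local_ring S /\ local_ring T,
      (forall a, exists s, pS s = a) /\ (forall a, exists t, pT t = a),
      ~ injective pS /\ ~ injective pT
    & ring_iso R (fiber_product pS pT)].

(** * Quasi-fiber product rings *)

(* [xs`_i] is a nonzerodivisor on [R / (xs`_0, ..., xs`_(i-1))] for all [i],
   and [R / (xs) <> 0]. *)
Definition regular_sequence (R : comNzRingType) (xs : seq R) : Prop :=
  (forall i, (i < size xs)%N -> forall r,
     ideal_gen (take i xs) (xs`_i * r) -> ideal_gen (take i xs) r) /\
  ~ ideal_gen xs 1.

(* The library's quotient rings are by boolean ideals, so [R / (xs)] is the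
   quotient by the (unique) boolean ideal with the same elements as [(xs)]. *)
Definition quasi_fiber_product_ring (R : comNzRingType) (xs : seq R) : Prop :=
  [/\ local_ring R, regular_sequence xs &
      exists2 I : idealr R, (forall r, r \in (I : {pred R}) <-> ideal_gen xs r) &
        fiber_product_ring {ideal_quot I}].

(** * Modules, projective resolutions and Ext *)

Section Modules.
Variable R : comNzRingType.

Definition fin_gen (M : lmodType R) : Prop :=
  exists (m : nat) (g : 'I_m -> M),
    forall v, exists c : 'I_m -> R, v = \sum_(i < m) c i *: g i.

Definition projective (P : lmodType R) : Prop :=
  forall (A B : lmodType R) (p : {linear A -> B}) (f : {linear P -> B}),
    (forall b, exists a, p a = b) ->
    exists g : {linear P -> A}, forall u, p (g u) = f u.

Definition injective_module (E : lmodType R) : Prop :=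
  forall (A B : lmodType R) (j : {linear A -> B}) (f : {linear A -> E}),
    injective j ->
    exists g : {linear B -> E}, forall a, g (j a) = f a.

Record proj_resolution (M : lmodType R) := ProjResolution {
  pr_obj :> nat -> lmodType R;
  pr_diff : forall i, {linear pr_obj i.+1 -> pr_obj i};
  pr_aug : {linear pr_obj 0%N -> M};
  pr_proj : forall i, projective (pr_obj i);
  pr_aug_surj : forall v, exists u, pr_aug u = v;
  pr_exact0 : forall u, pr_aug u = 0 <-> exists w, pr_diff 0%N w = u;
  pr_exactS : forall i u,
    pr_diff i u = 0 <-> exists w, pr_diff i.+1 w = u
}.

Definition cocycle (M N : lmodType R) (P : proj_resolution M) (i : nat)
    (f : {linear P i -> N}) : Prop :=
  forall u, f (pr_diff P i u) = 0.

Definition coboundary (M N : lmodType R) (P : proj_resolution M) (i : nat) :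
    {linear P i -> N} -> Prop :=
  match i with
  | 0%N => fun f => forall u, f u = 0
  | j.+1 => fun f =>
      exists g : {linear P j -> N}, forall u, f u = g (pr_diff P j u)
  end.

(* [Ext^i_R(M, N) = 0], i.e. [H^i(Hom_R(P, N)) = 0]; this does not depend on
   the choice of the projective resolution [P] of [M]. *)
Definition Ext_vanishes (i : nat) (M N : lmodType R) : Prop :=
  forall (P : proj_resolution M) (f : {linear P i -> N}),
    cocycle f -> coboundary f.

Record inj_resolution (M : lmodType R) := InjResolution {
  ir_obj :> nat -> lmodType R;
  ir_diff : forall i, {linear ir_obj i -> ir_obj i.+1};
  ir_aug : {linear M -> ir_obj 0%N};
  ir_inj : forall i, injective_module (ir_obj i);
  ir_aug_inj : injective ir_aug;
  ir_exact0 : forall u, ir_diff 0%N u = 0 <-> exists v, ir_aug v = u;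
  ir_exactS : forall i u,
    ir_diff i.+1 u = 0 <-> exists w, ir_diff i w = u
}.

Definition finite_injdim (M : lmodType R) : Prop :=
  exists (E : inj_resolution M) (d : nat),
    forall i, (d < i)%N -> forall u : E i, u = 0.

End Modules.

(** * The Uniform Auslander Condition *)

Definition uniform_Ext_bound (R : comNzRingType) (b : nat) : Prop :=
  forall M N : lmodType R, fin_gen M -> fin_gen N ->
    (exists i0, forall i, (i0 <= i)%N -> Ext_vanishes i M N) ->
    forall i, (b <= i)%N -> Ext_vanishes i M N.

Definition UAC (R : comNzRingType) : Prop := exists b, uniform_Ext_bound R b.

Definition is_Ext_index (R : comNzRingType) (b : nat) : Prop :=
  uniform_Ext_bound R b /\
  forall b', uniform_Ext_bound R b' -> (b <= b')%N.

Definition Gorenstein (R : comNzRingType) : Prop :=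
  local_ring R /\ finite_injdim (R^o : lmodType R).

Definition AB_ring (R : comNzRingType) : Prop := Gorenstein R /\ UAC R.

(* Main.v *)
Require Import Defs.
From HB Require Import structures.
From mathcomp Require Import all_boot all_order all_algebra.
From mathcomp Require Import ring_quotient.
From mathcomp.classical Require Import boolp.

Set Implicit Arguments.
Unset Strict Implicit.
Unset Printing Implicit Defensive.

Import GRing.Theory.
Local Open Scope ring_scope.

(** Let [m] be the maximal ideal of [R] and [X = (x)].  As [R / X] is a fiber
    product, there are ideals [I] and [J] of [R], not contained in [X], with
    [I + J = m] and [I /\ J = X] ([quasi_fiber_decomposition]).  All Ext groups
    below are over [R] and into a fixed finitely generated module [N]; the ring
    [R / X] only enters through its modules, which are [R]-modules killed by [X],
    and through [Ext^i (R / X, N) = 0] for [i > n] ([ext_zero_free_mod]).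

    Two facts about [m = I + J] drive the proof.

    First, let [U] be a nonzero finitely generated module killed by [J].  The
    kernel [L] of a minimal cover of [U] by [(R / X)^b] is contained in the
    maximal ideal times [(R / X)^b] and contains [(J / X)^b], so that [J / X] is a
    direct summand of [L].  Shifting degrees, [Ext^(i+1) (U, N) = 0] implies
    [Ext^i (J / X, N) = 0] for [i > n] ([ext_zero_killed]).  Since [J / X] is
    killed by [I], and [I / X] by [J], this can be iterated: if
    [Ext^i (J / X, N)] vanishes for [i >> 0], then [Ext^i (I / X, N)] and
    [Ext^i (J / X, N)] vanish for all [i > n], so that [Ext^i (R / m, N)] vanishes
    for all [i > n + 1] ([ext_zero_field]).  By Bass's argument the same then holds
    for [Ext^i (M, N)], for every finitely generated [M] ([ext_zero_residue]).

    Second, suppose that [Ext^i (M, N) = 0] for [i >> 0].  The sequence [x] is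
    regular on the [n]-th syzygy [Z] of [M], hence on the second syzygy [K] of [Z],
    taken as the kernel of a minimal cover by [R^g] of the first syzygy of [Z].  So
    [Ext^i (K / X K, N) = 0] for [i >> 0], and [K / X K] is the kernel of a map
    [(R / X)^g -> (R / X)^a] which lies in the maximal ideal times [(R / X)^g].
    That module is the direct sum of its parts with entries in [I / X] and in
    [J / X] ([kernel_split]), since a linear map preserves both types of
    entries.  If one of the parts is nonzero, it is a module [U] as above (up to
    exchanging [I] and [J]), and the conclusion holds.  If both are zero, then
    [K = X K], so [K = 0] by Nakayama, and [M] has projective dimension at most
    [n + 1].  In each case [Ext^i (M, N) = 0] for all [i >= n + 2]
    ([ext_zero_bound]).

    Vanishing of Ext is handled by [ext_zero], a recursive condition on short
    exact sequences that makes the needed parts of the long exact sequence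
    formal; [ext_zeroP] relates it to projective resolutions. *)

(** * Linear maps, submodules and subquotients *)

Section LinearMaps.
Variable R : comNzRingType.
Implicit Types A B C D : lmodType R.

(** The function [f] carrying its linearity proof, so that a bundled linear map
    can be inferred for it. *)
Definition lin_of A B (f : A -> B) (hf : linear f) : A -> B := f.
HB.instance Definition _ A B (f : A -> B) (hf : linear f) :=
  GRing.isLinear.Build R A B *:%R (lin_of hf) hf.

Lemma linear_exists A B (f : A -> B) :
  linear f -> exists g : {linear A -> B}, forall a, g a = f a.
Proof. by move=> hf; exists (lin_of hf). Qed.

(** A linear relation that is total and single-valued is the graph of a linear
    map.  All maps out of quotients and into submodules are obtained so. *)
Lemma linear_of_graph A B (G : A -> B -> Prop) :
  (forall a, exists b, G a b) ->
  (forall a b b', G a b -> G a b' -> b = b') ->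
  (forall r a b a' b', G a b -> G a' b' -> G (r *: a + a') (r *: b + b')) ->
  exists f : {linear A -> B}, forall a, G a (f a).
Proof.
move=> tot fun_ lin; have [f hf] := choice tot.
have lf : linear f.
  by move=> r a a'; apply: fun_ (hf _) _; apply: lin.
by have [g hg] := linear_exists lf; exists g => a; rewrite hg.
Qed.

Lemma factor_surj B C D (p : {linear B -> C}) (h : {linear B -> D}) :
  (forall c, exists b, p b = c) -> (forall b, p b = 0 -> h b = 0) ->
  exists h' : {linear C -> D}, forall b, h' (p b) = h b.
Proof.
move=> psurj kerp.
have wd b b' : p b = p b' -> h b = h b'.
  by move=> e; apply/eqP; rewrite -subr_eq0 -linearB kerp // linearB e subrr.
have [||| h' hh'] := @linear_of_graph C D (fun c d => exists2 b, p b = c & h b = d).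
- by move=> c; have [b <-] := psurj c; exists (h b), b.
- by move=> c d d' [b <- <-] [b' /esym e <-]; apply: wd.
- by move=> r _ _ _ _ [b <- <-] [b' <- <-]; exists (r *: b + b'); rewrite linearP.
exists h' => b; have [b' e <-] := hh' (p b); exact: wd.
Qed.

Lemma factor_inj A B D (i : {linear A -> B}) (h : {linear D -> B}) :
  injective i -> (forall d, exists a, i a = h d) ->
  exists h' : {linear D -> A}, forall d, i (h' d) = h d.
Proof.
move=> iinj him; apply: (@linear_of_graph D A (fun d a => i a = h d)) => //.
- by move=> d a a' e e'; apply: iinj; rewrite e.
- by move=> r a b a' b' e e'; rewrite !linearP e e'.
Qed.

End LinearMaps.

(** Submodules as closed predicates; a [submod R^o] is an ideal of [R]. *)
Record submod (R : comNzRingType) (V : lmodType R) := Submod {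
  mem_sub :> V -> Prop;
  memsub0 : mem_sub 0;
  memsubP : forall r u v, mem_sub u -> mem_sub v -> mem_sub (r *: u + v) }.

Section Submodules.
Variables (R : comNzRingType) (V : lmodType R).
Implicit Types D : submod V.

Lemma memsubD D u v : D u -> D v -> D (u + v).
Proof. by move=> hu hv; rewrite -[u]scale1r; apply: memsubP. Qed.

Lemma memsubZ D r u : D u -> D (r *: u).
Proof. by move=> hu; rewrite -[_ *: _]addr0; apply/memsubP/memsub0. Qed.

Lemma memsubN D u : D u -> D (- u).
Proof. by rewrite -scaleN1r; apply: memsubZ. Qed.

Lemma memsubB D u v : D u -> D v -> D (u - v).
Proof. by move=> hu hv; apply/memsubD/memsubN. Qed.

Lemma memsub_sum D I (r : seq I) (P : pred I) (F : I -> V) :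
  (forall i, P i -> D (F i)) -> D (\sum_(i <- r | P i) F i).
Proof.
by move=> h; apply: big_ind => //; [apply: memsub0 | move=> *; apply: memsubD].
Qed.

Definition sub_top : submod V := @Submod R V (fun=> True) Logic.I (fun _ _ _ _ _ => Logic.I).

Fact sub_zero_subproof r (u v : V) : u = 0 -> v = 0 -> r *: u + v = 0.
Proof. by move=> -> ->; rewrite scaler0 addr0. Qed.
Definition sub_zero : submod V := Submod (erefl 0) sub_zero_subproof.

Fact sub_cap_subproof D D' r u v :
  D u /\ D' u -> D v /\ D' v -> D (r *: u + v) /\ D' (r *: u + v).
Proof. by move=> [? ?] [? ?]; split; apply: memsubP. Qed.
Definition sub_cap D D' : submod V :=
  @Submod R V (fun v => D v /\ D' v) (conj (memsub0 D) (memsub0 D'))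
    (@sub_cap_subproof D D').

(** The submodule [D + R g]. *)
Fact sub_adj0 D g : exists r, D (0 - r *: g).
Proof. by exists 0; rewrite scale0r subr0; apply: memsub0. Qed.
Fact sub_adjP D g r (u v : V) : (exists c, D (u - c *: g)) -> (exists c, D (v - c *: g)) ->
  exists c, D ((r *: u + v) - c *: g).
Proof.
move=> [a ha] [b hb]; exists (r * a + b).
rewrite scalerDl -scalerA opprD addrACA -scalerBr; exact: memsubP.
Qed.
Definition sub_adj D g : submod V := Submod (sub_adj0 D g) (@sub_adjP D g).

Lemma sub_adj_sub D g v : D v -> sub_adj D g v.
Proof. by exists 0; rewrite scale0r subr0. Qed.

Lemma sub_adj_gen D g : sub_adj D g g.
Proof. by exists 1; rewrite scale1r subrr; apply: memsub0. Qed.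

End Submodules.

Arguments sub_top {R V}.
Arguments sub_zero {R V}.

(** The preimage of a submodule. *)
Section Comap.
Variables (R : comNzRingType) (V W : lmodType R) (h : {linear V -> W}).
Fact comap0 (D : submod W) : D (h 0).
Proof. by rewrite linear0; apply: memsub0. Qed.
Fact comapP (D : submod W) r u v : D (h u) -> D (h v) -> D (h (r *: u + v)).
Proof. by rewrite linearP; apply: memsubP. Qed.
Definition comap (D : submod W) : submod V :=
  @Submod R V (fun v => D (h v)) (comap0 D) (@comapP D).
End Comap.

Section Subquotient.
Variables (R : comNzRingType) (V : lmodType R) (D1 D2 : submod V).

(** The chosen representative of the coset of [v]. *)
Definition sq_nf (v : V) : V := choose (fun w => `[< D1 w /\ D2 (v - w) >]) v.

Lemma sq_nfP v : D1 v -> D1 (sq_nf v) /\ D2 (v - sq_nf v).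
Proof.
move=> hv; apply/asboolP; rewrite /sq_nf.
apply: (@chooseP _ (fun w => `[< D1 w /\ D2 (v - w) >])).
by apply/asboolP; rewrite subrr; split=> //; apply: memsub0.
Qed.

Lemma sq_nfE v w : D1 v -> D1 w -> D2 (v - w) -> sq_nf v = sq_nf w.
Proof.
move=> hv hw hvw; rewrite /sq_nf.
transitivity (choose (fun u => `[< D1 u /\ D2 (v - u) >]) w).
  by apply: choose_id; apply/asboolP; split=> //; rewrite subrr; apply: memsub0.
apply: eq_choose => u; apply/asbool_equiv_eq; split=> -[hu h]; split=> //.
  by rewrite -[_ - _](subrKA v) addrC -[w - v]opprB; apply: memsubB.
by rewrite -[v - u](subrKA w); apply: memsubD.
Qed.

(** The module [D1 / (D1 /\ D2)], realized as the type of chosen representatives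
    of cosets.  It serves for submodules ([D2 = 0]), for quotients ([D1 = V]) and
    for [D1 / D2]; the inclusion of [D2] in [D1] is not required. *)
Definition subquot := {v : V | `[< D1 v >] && (sq_nf v == v)}.
HB.instance Definition _ := Choice.on subquot.

Lemma sqP (q : subquot) : D1 (val q).
Proof. by have /andP[/asboolP] := valP q. Qed.

Fact sq_mk_subproof v (hv : D1 v) : `[< D1 (sq_nf v) >] && (sq_nf (sq_nf v) == sq_nf v).
Proof.
have [h1 h2] := sq_nfP hv; apply/andP; split; first exact/asboolP.
by apply/eqP/sq_nfE => //; rewrite -opprB; apply: memsubN.
Qed.
Definition sq_mk v (hv : D1 v) : subquot := Sub (sq_nf v) (sq_mk_subproof hv).

Lemma sq_mkE v w (hv : D1 v) (hw : D1 w) : D2 (v - w) -> sq_mk hv = sq_mk hw.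
Proof. by move=> h; apply: val_inj; apply: sq_nfE. Qed.

Lemma sq_mk_val (q : subquot) (h : D1 (val q)) : sq_mk h = q.
Proof. by apply: val_inj => /=; apply/eqP; have /andP[] := valP q. Qed.

Lemma val_sq_mk v (hv : D1 v) : D2 (v - val (sq_mk hv)).
Proof. by have [] := sq_nfP hv. Qed.

Definition sq_add q q' := sq_mk (memsubD (sqP q) (sqP q')).
Definition sq_opp q := sq_mk (memsubN (sqP q)).
Definition sq_scale r q := sq_mk (memsubZ r (sqP q)).

Lemma sq_addE v w (hv : D1 v) (hw : D1 w) (hvw : D1 (v + w)) :
  sq_add (sq_mk hv) (sq_mk hw) = sq_mk hvw.
Proof.
apply: sq_mkE; rewrite -opprB; apply: memsubN; rewrite opprD addrACA.
by apply: memsubD; apply: val_sq_mk.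
Qed.

Lemma sq_scaleE r v (hv : D1 v) (hrv : D1 (r *: v)) :
  sq_scale r (sq_mk hv) = sq_mk hrv.
Proof.
apply: sq_mkE; rewrite -opprB -scalerBr; apply: memsubN.
by apply: memsubZ; apply: val_sq_mk.
Qed.

Lemma sq_mkP (P : subquot -> Prop) : (forall v (hv : D1 v), P (sq_mk hv)) -> forall q, P q.
Proof. by move=> h q; rewrite -(sq_mk_val (sqP q)). Qed.

Lemma sq_eq v w (hv : D1 v) (hw : D1 w) : v = w -> sq_mk hv = sq_mk hw.
Proof. by move=> e; apply: sq_mkE; rewrite e subrr; apply: memsub0. Qed.

Fact sq_addA : associative sq_add.
Proof.
elim/sq_mkP=> u hu; elim/sq_mkP=> v hv; elim/sq_mkP=> w hw.
have huv := memsubD hu hv; have hvw := memsubD hv hw.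
rewrite (sq_addE hv hw hvw) (sq_addE hu hv huv).
rewrite (sq_addE hu hvw (memsubD hu hvw)) (sq_addE huv hw (memsubD huv hw)).
by apply: sq_eq; rewrite addrA.
Qed.

Fact sq_addC : commutative sq_add.
Proof. by move=> q q'; apply: sq_eq; rewrite addrC. Qed.

Fact sq_add0 : left_id (sq_mk (memsub0 D1)) sq_add.
Proof.
elim/sq_mkP=> v hv; rewrite (sq_addE _ _ (memsubD (memsub0 D1) hv)).
by apply: sq_eq; rewrite add0r.
Qed.

Fact sq_addN : left_inverse (sq_mk (memsub0 D1)) sq_opp sq_add.
Proof.
move=> q; rewrite -{2}(sq_mk_val (sqP q)).
rewrite (sq_addE _ _ (memsubD (memsubN (sqP q)) (sqP q))).
by apply: sq_eq; rewrite addNr.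
Qed.

HB.instance Definition _ :=
  GRing.isZmodule.Build subquot sq_addA sq_addC sq_add0 sq_addN.

Fact sq_scaleA a b q : sq_scale a (sq_scale b q) = sq_scale (a * b) q.
Proof.
rewrite (sq_scaleE _ (memsubZ a (memsubZ b (sqP q)))).
by apply: sq_eq; rewrite scalerA.
Qed.

Fact sq_scale1 : left_id 1 sq_scale.
Proof.
by move=> q; rewrite -{2}(sq_mk_val (sqP q)); apply: sq_eq; rewrite scale1r.
Qed.

Fact sq_scaleDr : right_distributive sq_scale +%R.
Proof.
move=> r; elim/sq_mkP=> v hv; elim/sq_mkP=> w hw.
rewrite [_ + _](sq_addE _ _ (memsubD hv hw)).
rewrite (sq_scaleE _ (memsubZ r (memsubD hv hw))) !(sq_scaleE _ (memsubZ r _)).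
rewrite [RHS](sq_addE _ _ (memsubD (memsubZ r hv) (memsubZ r hw))).
by apply: sq_eq; rewrite scalerDr.
Qed.

Fact sq_scaleDl q : {morph sq_scale^~ q : a b / a + b}.
Proof.
move=> a b; rewrite [RHS](sq_addE _ _ (memsubD (memsubZ a (sqP q)) (memsubZ b (sqP q)))).
by apply: sq_eq; rewrite scalerDl.
Qed.

HB.instance Definition _ :=
  GRing.Zmodule_isLmodule.Build R subquot sq_scaleA sq_scale1 sq_scaleDr sq_scaleDl.

(** [rep q v] says that [v] lies in [D1] and that [q] is its class. *)
Definition rep (q : subquot) (v : V) : Prop := D1 v /\ D2 (v - val q).

Lemma rep_mem q v : rep q v -> D1 v.
Proof. by case. Qed.

Lemma rep_ex q : exists v, rep q v.
Proof. by exists (val q); split; [apply: sqP | rewrite subrr; apply: memsub0]. Qed.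

Lemma rep_mk v (hv : D1 v) : rep (sq_mk hv) v.
Proof. by split=> //; apply: val_sq_mk. Qed.

Lemma rep_cls v : D1 v -> exists q, rep q v.
Proof. by move=> hv; exists (sq_mk hv); apply: rep_mk. Qed.

Lemma rep_eq q v (hv : D1 v) : rep q v -> q = sq_mk hv.
Proof.
move=> [_ h]; rewrite -(sq_mk_val (sqP q)); apply: sq_mkE.
by rewrite -opprB; apply: memsubN.
Qed.

Lemma rep_fun q q' v : rep q v -> rep q' v -> q = q'.
Proof. by move=> h h'; rewrite (rep_eq h.1 h) (rep_eq h.1 h'). Qed.

Lemma rep_lin r q v q' v' : rep q v -> rep q' v' -> rep (r *: q + q') (r *: v + v').
Proof.
move=> h h'; have hrv := memsubZ r h.1.
rewrite (rep_eq h.1 h) (rep_eq h'.1 h') [r *: _](sq_scaleE _ hrv).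
rewrite [_ + _](sq_addE _ _ (memsubD hrv h'.1)); exact: rep_mk.
Qed.

Lemma rep00 : rep 0 0.
Proof. exact: rep_mk (memsub0 D1). Qed.

Lemma repZ r q v : rep q v -> rep (r *: q) (r *: v).
Proof. by move=> h; rewrite -[r *: q]addr0 -[r *: v]addr0; apply/rep_lin/rep00. Qed.

Lemma repD q v q' v' : rep q v -> rep q' v' -> rep (q + q') (v + v').
Proof. by move=> h; rewrite -[q]scale1r -[v]scale1r; apply: rep_lin. Qed.

Lemma repB q v q' v' : rep q v -> rep q' v' -> rep (q - q') (v - v').
Proof. by move=> h h'; rewrite -!scaleN1r; apply/repD/repZ. Qed.

Lemma rep0 q v : rep q v -> (q = 0 <-> D2 v).
Proof.
move=> h; rewrite (rep_eq h.1 h); split=> [e|h2].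
  have h0 : rep (sq_mk h.1) 0 by rewrite e; apply: rep_mk.
  rewrite -[v]subr0 -(subrKA (val (sq_mk h.1))); apply: memsubD.
    by have [] := rep_mk h.1.
  by rewrite -opprB; apply: memsubN; case: h0.
by apply: sq_mkE; rewrite subr0.
Qed.

Lemma rep_inj q v v' : rep q v -> rep q v' -> D2 (v - v').
Proof. by move=> h h'; apply/(rep0 (repB h h')); rewrite subrr. Qed.

Lemma rep_eqP q q' v v' : rep q v -> rep q' v' -> D2 (v - v') -> q = q'.
Proof. by move=> h h' /(rep0 (repB h h')) /eqP; rewrite subr_eq0 => /eqP. Qed.

End Subquotient.

(** * Short exact sequences *)

Section ShortExact.
Variable R : comNzRingType.
Implicit Types A B C X Y Z : lmodType R.

(** [0 -> A -> B -> C -> 0] is exact. *)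
Definition short_exact A B C (i : {linear A -> B}) (p : {linear B -> C}) : Prop :=
  [/\ injective i, (forall c, exists b, p b = c)
    & forall b, p b = 0 <-> exists a, i a = b].

Lemma linear_inj0 A B (i : {linear A -> B}) :
  (forall a, i a = 0 -> a = 0) -> injective i.
Proof.
by move=> h a b e; apply/eqP; rewrite -subr_eq0; apply/eqP/h; rewrite linearB e subrr.
Qed.

Lemma short_exact0 A B C (i : {linear A -> B}) (p : {linear B -> C}) :
  short_exact i p -> forall a, p (i a) = 0.
Proof. by case=> _ _ h a; apply/h; exists a. Qed.

Lemma rep_sub_inj (V : lmodType R) (D : submod V) (q : subquot D sub_zero) v v' :
  rep q v -> rep q v' -> v = v'.
Proof.
move=> [_ /= e] [_ /= e']; apply/eqP; rewrite -subr_eq0.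
by rewrite -[v - v'](subrKA (val q)) e -opprB e' subrr.
Qed.

Lemma sub_incl (V : lmodType R) (D : submod V) :
  exists i : {linear subquot D sub_zero -> V},
    [/\ injective i, (forall v, D v <-> exists a, i a = v) & forall a, rep a (i a)].
Proof.
have [|||i hi] := @linear_of_graph R (subquot D sub_zero) V (fun q v => rep q v).
- exact: rep_ex.
- by move=> q v v'; apply: rep_sub_inj.
- by move=> *; apply: rep_lin.
exists i; split=> //.
- by apply: linear_inj0 => a e; apply/(rep0 (hi a)).
- move=> v; split=> [hv|[a <-]]; last exact: rep_mem (hi a).
  exists (sq_mk sub_zero hv); exact: rep_sub_inj (hi _) (rep_mk _ _).
Qed.

Definition kernel_sub A B (p : {linear A -> B}) : submod A := comap p sub_zero.

Lemma kernel_exact B C (p : {linear B -> C}) : (forall c, exists b, p b = c) ->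
  exists i : {linear subquot (kernel_sub p) sub_zero -> B}, short_exact i p.
Proof. by move=> psurj; have [i [? ? _]] := sub_incl (kernel_sub p); exists i. Qed.

(** The pullback [W] of [B -> C] and [Y -> C], an extension of [B] by [X] and of
    [Y] by [A]. *)
Lemma pullback A B C X Y (j : {linear A -> B}) (q : {linear B -> C})
    (i : {linear X -> Y}) (p : {linear Y -> C}) :
  short_exact j q -> short_exact i p ->
  exists (W : lmodType R) (i' : {linear X -> W}) (b : {linear W -> B})
    (j' : {linear A -> W}) (y : {linear W -> Y}),
    [/\ short_exact i' b, short_exact j' y, forall x, y (i' x) = i x
      & forall a, b (j' a) = j a].
Proof.
move=> [jI qS qK] [iI pS pK].
have [phi hphi] : exists phi : {linear (B * Y)%type -> C}, forall u, phi u = q u.1 - p u.2.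
  by exists ((q \o fst) \- (p \o snd)).
have [w [wI wK _]] := sub_incl (kernel_sub phi).
have inW bb yy : q bb = p yy -> exists z, w z = (bb, yy).
  by move=> e; apply/wK; rewrite /= hphi /= e subrr.
have outW z : q (w z).1 = p (w z).2.
  by apply/eqP; rewrite -subr_eq0 -hphi; apply/eqP/wK; exists z.
have [fi hfi] : exists f : {linear X -> (B * Y)%type}, forall x, f x = (0, i x).
  by apply: linear_exists => r u v /=; apply/eqP; rewrite xpair_eqE /= scaler0 addr0 linearP !eqxx.
have [fj hfj] : exists f : {linear A -> (B * Y)%type}, forall x, f x = (j x, 0).
  by apply: linear_exists => r u v /=; apply/eqP; rewrite xpair_eqE /= scaler0 addr0 linearP !eqxx.
have [|i' hi'] := factor_inj (h := fi) wI.
  by move=> x; rewrite hfi; apply: inW; rewrite linear0; apply/esym/pK; exists x.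
have [|j' hj'] := factor_inj (h := fj) wI.
  by move=> x; rewrite hfj; apply: inW; rewrite linear0; apply/qK; exists x.
exists (subquot (kernel_sub phi) sub_zero), i', (fst \o w), j', (snd \o w); split.
- split=> [x x' e|bb|z] /=.
  + by apply: iI; have := congr1 (snd \o w) e; rewrite /= !hi' !hfi.
  + by have [yy e] := pS (q bb); have [z hz] := inW _ _ (esym e); exists z; rewrite hz.
  + split=> [e|[x <-]]; last by rewrite hi' hfi.
    have := outW z; rewrite e linear0 => /esym/pK[x ex]; exists x; apply: wI.
    by rewrite hi' hfi ex -e -surjective_pairing.
- split=> [x x' e|yy|z] /=.
  + by apply: jI; have := congr1 (fst \o w) e; rewrite /= !hj' !hfj.
  + by have [bb e] := qS (p yy); have [z hz] := inW _ _ e; exists z; rewrite hz.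
  + split=> [e|[x <-]]; last by rewrite hj' hfj.
    have := outW z; rewrite e linear0 => /qK[x ex]; exists x; apply: wI.
    by rewrite hj' hfj ex -e -surjective_pairing.
- by move=> x /=; rewrite hi' hfi.
- by move=> x /=; rewrite hj' hfj.
Qed.

(** The kernel [Z] of [Y -> B -> C] is an extension of [A = ker (B -> C)] by
    [X = ker (Y -> B)]. *)
Lemma kernel_comp A B C X Y (i : {linear A -> B}) (p : {linear B -> C})
    (u : {linear X -> Y}) (v : {linear Y -> B}) :
  short_exact i p -> short_exact u v ->
  exists (Z : lmodType R) (s : {linear Z -> Y}) (t : {linear X -> Z})
    (w : {linear Z -> A}),
    [/\ short_exact s (p \o v), short_exact t w & forall x, s (t x) = u x].
Proof.
move=> [iI pS pK] [uI vS vK].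
have pvS c : exists y, (p \o v) y = c.
  by have [b <-] := pS c; have [y <-] := vS b; exists y.
have [s hs] := kernel_exact pvS; have [sI _ sK] := hs.
have [|t ht] := factor_inj (h := u) sI.
  by move=> x; apply/sK => /=; rewrite (_ : v (u x) = 0) ?linear0 //; apply/vK; exists x.
have [|w hw] := factor_inj (h := v \o s) iI.
  by move=> z; apply/pK; apply: (short_exact0 hs).
exists (subquot (kernel_sub (p \o v)) sub_zero), s, t, w; split=> //; split.
- by move=> x x' e; apply: uI; rewrite -!ht e.
- move=> a; have [y hy] := vS (i a).
  have /sK[z hz] : (p \o v) y = 0 by rewrite /= hy; apply/pK; exists a.
  by exists z; apply: iI; rewrite hw /= hz.
- move=> z; split=> [e|[x <-]].
  + have /vK[x hx] : v (s z) = 0 by have := hw z; rewrite e linear0 /=.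
    by exists x; apply: sI; rewrite ht.
  + by apply: iI; rewrite hw linear0 /= ht; apply/vK; exists x.
Qed.

Lemma short_exact_split A B (Q : lmodType R) (i : {linear A -> B}) (p : {linear B -> Q}) :
  projective Q -> short_exact i p ->
  exists (s : {linear Q -> B}) (h : {linear B -> A}),
    [/\ forall x, p (s x) = x, forall b, i (h b) = b - s (p b) & forall a, h (i a) = a].
Proof.
move=> projQ [iI pS pK]; have [s hs] := projQ _ _ p idfun pS.
have [|h hh] := factor_inj (h := (idfun \- (s \o p)) : {linear B -> B}) iI.
  by move=> b; apply/pK; rewrite /= linearB /= hs subrr.
exists s, h; split=> // a; apply: iI; rewrite hh /= (_ : p (i a) = 0) ?linear0 ?oppr0 ?addr0 //.
by apply/pK; exists a.
Qed.

Lemma prod_inl A B : exists f : {linear A -> (A * B)%type}, forall a, f a = (a, 0).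
Proof.
by apply: linear_exists => r u v; apply/eqP; rewrite xpair_eqE /= scaler0 addr0 !eqxx.
Qed.

Lemma prod_inr A B : exists f : {linear B -> (A * B)%type}, forall a, f a = (0, a).
Proof.
by apply: linear_exists => r u v; apply/eqP; rewrite xpair_eqE /= scaler0 addr0 !eqxx.
Qed.

Lemma short_exact_prod A B (f : {linear A -> (A * B)%type}) :
  (forall a, f a = (a, 0)) -> short_exact f (snd : {linear (A * B)%type -> B}).
Proof.
move=> hf; split=> [a a'|b|[a b]] /=; first by rewrite !hf => -[].
  by exists (0, b).
by split=> [->|[a' ]]; [exists a; rewrite hf | rewrite hf => -[]].
Qed.

Lemma prod_map A B C X (f : {linear A -> B}) (g : {linear C -> X}) :
  exists h : {linear (A * C)%type -> (B * X)%type}, forall u, h u = (f u.1, g u.2).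
Proof.
by apply: linear_exists => r u v; apply/eqP; rewrite xpair_eqE /= !linearP !eqxx.
Qed.

Lemma short_exact_prod2 A B C X Y Z (i : {linear A -> B}) (p : {linear B -> C})
    (i' : {linear X -> Y}) (p' : {linear Y -> Z})
    (f : {linear (A * X)%type -> (B * Y)%type}) (g : {linear (B * Y)%type -> (C * Z)%type}) :
  short_exact i p -> short_exact i' p' ->
  (forall u, f u = (i u.1, i' u.2)) -> (forall u, g u = (p u.1, p' u.2)) ->
  short_exact f g.
Proof.
move=> [iI pS pK] [iI' pS' pK'] hf hg; split.
- by move=> [a x] [a' x']; rewrite !hf /= => -[/iI -> /iI' ->].
- by move=> [c z]; have [b <-] := pS c; have [y <-] := pS' z; exists (b, y); rewrite hg.
- move=> [b y]; rewrite hg /=; split=> [[/pK[a <-] /pK'[x <-]]|[[a x]]].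
    by exists (a, x); rewrite hf.
  rewrite hf /= => -[<- <-].
  by rewrite (pK (i a)).2 ?(pK' (i' x)).2 //; [exists x | exists a].
Qed.

End ShortExact.

(** * Vanishing of Ext and its long exact sequence *)

Section ExtZero.
Variables (R : comNzRingType) (N : lmodType R).
Implicit Types A B C X Y Q : lmodType R.

(** [ext_zero k C] says that [Ext^(k+1) (C, N) = 0].  For [k = 0], every map to
    [N] extends along every embedding with cokernel [C].  The successor step reads
    off [Ext^(k+1) B -> Ext^(k+1) A -> Ext^(k+2) C]: if [Ext^(k+2) C] vanishes and
    [Ext^(k+1) B] does, then so does [Ext^(k+1) A]; for projective [B] this
    characterizes the vanishing of [Ext^(k+2) C].  No resolution is involved. *)
Fixpoint ext_zero (k : nat) (C : lmodType R) : Prop :=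
  match k with
  | 0%N => forall A B (i : {linear A -> B}) (p : {linear B -> C}), short_exact i p ->
      forall f : {linear A -> N}, exists g : {linear B -> N}, forall a, g (i a) = f a
  | k'.+1 => forall A B (i : {linear A -> B}) (p : {linear B -> C}), short_exact i p ->
      ext_zero k' B -> ext_zero k' A
  end.

Lemma ext_zero_left k A B C (i : {linear A -> B}) (p : {linear B -> C}) :
  short_exact i p -> ext_zero k.+1 C -> ext_zero k B -> ext_zero k A.
Proof. by move=> h hC; apply: hC h. Qed.

(** Invariance under isomorphism, in both directions. *)
Lemma ext_zero_inv k A B (g : {linear B -> A}) :
  (forall a, exists b, g b = a) -> injective g -> ext_zero k A -> ext_zero k B.
Proof.
move=> gS gI; have ses X Y (i : {linear X -> Y}) (p : {linear Y -> B}) :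
    short_exact i p -> short_exact i (g \o p).
  move=> [iI pS pK]; split=> // [a|y].
    by have [b <-] := gS a; have [y <-] := pS b; exists y.
  by rewrite -pK /=; split=> [|->]; rewrite ?linear0 // -[in X in X -> _](linear0 g) => /gI.
by case: k => [|k] hA X Y i p /ses; apply: hA.
Qed.

Lemma ext_zero_iso k A B (f : {linear A -> B}) :
  (forall b, exists a, f a = b) -> injective f -> ext_zero k A -> ext_zero k B.
Proof.
move=> fS fI; have [//|g hg] := factor_inj (h := idfun : {linear B -> B}) fI.
apply: (@ext_zero_inv _ _ _ g) => [a|b b' e]; last by have := congr1 f e; rewrite !hg.
by exists (f a); apply: fI; rewrite hg.
Qed.

Lemma ext_zero_mid k A B C (i : {linear A -> B}) (p : {linear B -> C}) :
  short_exact i p -> ext_zero k A -> ext_zero k C -> ext_zero k B.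
Proof.
move=> h; case: k => [|k] hA hC X Y u v huv;
  have [Z [s [t [w [hs ht e]]]]] := kernel_comp h huv.
  move=> f; have [g hg] := hA _ _ _ _ ht f; have [g' hg'] := hC _ _ _ _ hs g.
  by exists g' => x; rewrite -e hg' hg.
by move=> hY; apply: (hA _ _ _ _ ht); apply: (hC _ _ _ _ hs).
Qed.

Lemma ext_zero_right k A B C (i : {linear A -> B}) (p : {linear B -> C}) :
  short_exact i p -> ext_zero k A -> ext_zero k.+1 B -> ext_zero k.+1 C.
Proof.
move=> h hA hB X Y u v huv hY.
have [W [i' [b [j' [y [h1 h2 _ _]]]]]] := pullback h huv.
exact: hB h1 (ext_zero_mid h2 hA hY).
Qed.

(** Degree zero: if [Hom B -> Hom A] is onto and [Ext^1 B = 0], then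
    [Ext^1 C = 0]. *)
Lemma ext_zero_right0 A B C (i : {linear A -> B}) (p : {linear B -> C}) :
  short_exact i p ->
  (forall f : {linear A -> N}, exists g : {linear B -> N}, forall a, g (i a) = f a) ->
  ext_zero 0 B -> ext_zero 0 C.
Proof.
move=> h hA hB X Y u v huv f.
have [W [i' [b [j' [y [h1 h2 e1 e2]]]]]] := pullback h huv.
have [f' hf'] := hB _ _ _ _ h1 f; have [g hg] := hA (f' \o j').
have [yI yS yK] := h2.
have [||f'' hf''] := factor_surj (p := y) (h := f' \- (g \o b)).
- exact: yS.
- by move=> w /yK[a <-] /=; rewrite e2 hg subrr.
exists f'' => x; rewrite -e1 hf'' /= (short_exact0 h1) linear0 subr0; exact: hf'.
Qed.

Lemma ext_zero_prod k A B : ext_zero k A -> ext_zero k B -> ext_zero k (A * B)%type.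
Proof. by have [f hf] := prod_inl A B; apply: ext_zero_mid (short_exact_prod hf). Qed.

Lemma short_exact_prodr A X Y Q (i : {linear X -> Y}) (p : {linear Y -> A}) :
  short_exact i p -> exists (i' : {linear X -> (Y * Q)%type})
    (p' : {linear (Y * Q)%type -> (A * Q)%type}),
    short_exact i' p' /\ forall x, i' x = (i x, 0).
Proof.
move=> [iI pS pK]; have [f hf] := prod_inl Y Q.
have [g hg] := prod_map p (idfun : {linear Q -> Q}).
exists (f \o i), g; split=> [|x]; last by rewrite /= hf.
split=> [x x'|[a c]|[y c]]; first by rewrite /= !hf => -[/iI].
  by have [y <-] := pS a; exists (y, c); rewrite hg.
rewrite hg /=; split=> [[/pK[x <-] ->]|[x]]; first by exists x; rewrite hf.
by rewrite hf => -[<- <-]; rewrite (pK (i x)).2 //; exists x.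
Qed.

(** The second clause is what the first one needs in the next degree: an
    extension of [Q] by [A] splits as [A * Q]. *)
Lemma ext_zero_projective_aux k :
  (forall Q, projective Q -> ext_zero k Q) /\
  (forall A Q, projective Q -> ext_zero k (A * Q)%type -> ext_zero k A).
Proof.
elim: k => [|k [IHa IHb]]; split.
- move=> Q hQ A B i p hip f; have [s [h [_ _ hh]]] := short_exact_split hQ hip.
  by exists (f \o h) => a; rewrite /= hh.
- move=> A Q hQ hA X Y i p hip f.
  have [i' [p' [hip' e]]] := short_exact_prodr Q hip.
  have [g hg] := hA _ _ _ _ hip' f; have [l hl] := prod_inl Y Q.
  by exists (g \o l) => x; rewrite /= hl -e hg.
- move=> Q hQ A B i p hip hB; have [s [h [h1 h2 h3]]] := short_exact_split hQ hip.
  apply: (IHb A Q hQ).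
  have [f hf] : exists f : {linear (A * Q)%type -> B}, forall u, f u = i u.1 + s u.2.
    by exists ((i \o fst) \+ (s \o snd)).
  apply: (ext_zero_inv (g := f)) hB.
    by move=> b; exists (h b, p b); rewrite hf /= h2 subrK.
  apply: linear_inj0 => -[a c]; rewrite hf /= => e.
  have := congr1 p e; rewrite linearD (short_exact0 hip) add0r h1 linear0 => ec.
  by move: e; rewrite ec linear0 addr0 => /(congr1 h); rewrite h3 linear0 => ->.
- move=> A Q hQ hA X Y i p hip hY.
  have [i' [p' [hip' e]]] := short_exact_prodr Q hip.
  by apply: hA hip' _; apply: ext_zero_prod => //; apply: IHa.
Qed.

Lemma ext_zero_projective k Q : projective Q -> ext_zero k Q.
Proof. by have [h _] := ext_zero_projective_aux k; apply: h. Qed.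

End ExtZero.

(** * Finitely generated modules *)

Section FinGen.
Variable R : comNzRingType.
Implicit Types A B C V : lmodType R.

Lemma row_linear V m (g : 'I_m -> V) :
  exists f : {linear 'rV[R]_m -> V}, forall r, f r = \sum_(i < m) r 0 i *: g i.
Proof.
apply: linear_exists => a u v; rewrite scaler_sumr -big_split /=.
by apply: eq_bigr => i _; rewrite !mxE scalerDl scalerA.
Qed.

Lemma projective_row m : projective ('rV[R]_m : lmodType R).
Proof.
move=> A B p f pS; have [a ha] := choice (fun i => pS (f (delta_mx 0 i))).
have [g hg] := row_linear a; exists g => u.
rewrite hg linear_sum {2}(row_sum_delta u) linear_sum.
by apply: eq_bigr => i _; rewrite !linearZ /= ha.
Qed.

Lemma scale_linear V (v : V) : exists h : {linear R^o -> V}, forall r, h r = (r : R) *: v.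
Proof. by apply: linear_exists => r a b; rewrite scalerDl scalerA. Qed.

Lemma coord_linear b l : exists h : {linear 'rV[R]_b -> R^o}, forall v : 'rV[R]_b, h v = v 0 l.
Proof. by apply: linear_exists => r u v; rewrite !mxE. Qed.

Lemma projective_regular : projective (R^o : lmodType R).
Proof.
move=> A B p f pS; have [a ha] := pS (f 1); have [g hg] := scale_linear a.
by exists g => r; rewrite hg linearZ /= ha -linearZ /= [_ *: _]mulr1.
Qed.

Lemma fin_gen_regular : fin_gen (R^o : lmodType R).
Proof.
by exists 1%N, (fun=> 1) => v; exists (fun=> v); rewrite big_ord1 [RHS]mulr1.
Qed.

Lemma fin_gen_cover V : fin_gen V ->
  exists m, exists c : {linear 'rV[R]_m -> V}, forall v, exists r, c r = v.
Proof.
move=> [m [g hg]]; have [c hc] := row_linear g; exists m, c => v.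
have [a ->] := hg v; exists (\row_i a i); rewrite hc.
by apply: eq_bigr => i _; rewrite mxE.
Qed.

Lemma fin_gen_finType V (T : finType) (g : T -> V) :
  (forall v, exists c : T -> R, v = \sum_t c t *: g t) -> fin_gen V.
Proof.
move=> hg; exists #|T|, (fun i => g (enum_val i)) => v.
have [c ->] := hg v; exists (fun i => c (enum_val i)).
by rewrite (reindex _ (onW_bij _ (enum_val_bij T))).
Qed.

Lemma fin_gen_row m : fin_gen ('rV[R]_m : lmodType R).
Proof. by exists m, (delta_mx 0) => v; exists (v 0); apply: row_sum_delta. Qed.

(** The span of a list, as nested sums [D + R g]. *)
Definition lspan V (s : seq V) : submod V := foldr (fun g D => sub_adj D g) sub_zero s.

Lemma lspanP V (s : seq V) v :
  lspan s v <-> exists c : 'I_(size s) -> R, v = \sum_(i < size s) c i *: s`_i.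
Proof.
elim: s v => [|g s IH] v /=.
  by split=> [->|[c ->]]; [exists (fun=> 0) |]; rewrite big_ord0.
split=> [[r /IH[c hc]]|[c hc]].
  exists (fun i => if unlift ord0 i is Some j then c j else r).
  rewrite big_ord_recl unlift_none /=; apply/eqP; rewrite addrC -subr_eq hc.
  by apply/eqP/eq_bigr => i _; rewrite liftK.
exists (c ord0); apply/IH; exists (fun i => c (lift ord0 i)).
by rewrite hc big_ord_recl /= addrAC subrr add0r.
Qed.

Lemma lspan_sub V (s : seq V) (D : submod V) :
  (forall g, g \in s -> D g) -> forall v, lspan s v -> D v.
Proof.
move=> h v /lspanP[c ->]; apply: memsub_sum => i _; apply: memsubZ.
by apply/h/mem_nth.
Qed.

Lemma mem_lspan V (s : seq V) g : g \in s -> lspan s g.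
Proof.
elim: s => //= h s IH; rewrite inE => /orP[/eqP ->|/IH]; first exact: sub_adj_gen.
exact: sub_adj_sub.
Qed.

Lemma fin_gen_span V : fin_gen V <-> exists s, forall v : V, lspan s v.
Proof.
split=> [[m [g hg]]|[s hs]].
  exists [seq g i | i <- enum 'I_m] => v; have [c ->] := hg v.
  apply: memsub_sum => i _; apply/memsubZ/mem_lspan/map_f; exact: mem_enum.
by exists (size s), (nth 0 s) => v; apply/lspanP/hs.
Qed.

Hypothesis noethR : noetherian R.

Lemma noetherian_submod V (s : seq V) (D : submod V) :
  (forall v, D v -> lspan s v) -> exists t, forall v, D v <-> lspan t v.
Proof.
(* By induction on the spanning list [g :: s]: [D] is generated by lifts of
   generators of the ideal of coefficients of [g] in [D], together with
   generators of [D /\ span s]. *)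
elim: s D => [|g s IH] D hD.
  exists [::] => v; split=> [/hD //|/= ->]; exact: memsub0.
pose a r := exists2 v, D v & lspan s (v - r *: g).
have [|ys hys] := noethR (I := a).
  split.
  - exists 0; rewrite ?scale0r ?subr0; exact: memsub0.
  - move=> r r' [v hv e] [v' hv' e']; exists (v + v'); first exact: memsubD.
    by rewrite scalerDl opprD addrACA; apply: memsubD.
  - move=> r r' [v hv e]; exists (r *: v); first exact: memsubZ.
    by rewrite -scalerA -scalerBr; apply: memsubZ.
have [|t ht] := IH (sub_cap D (lspan s)); first by move=> v [].
have hyv (i : 'I_(size ys)) : exists v, D v /\ lspan s (v - ys`_i *: g).
  suff [v ? ?] : a ys`_i by exists v.
  apply/hys; exists (fun j => (j == i)%:R); rewrite (bigD1 i) //= eqxx mul1r.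
  by rewrite big1 ?addr0 // => j /negPf ->; rewrite mul0r.
have [w hw] := choice hyv.
exists ([seq w i | i <- enum 'I_(size ys)] ++ t) => v; split=> [hv|].
  have [r hr] := hD v hv; have /hys[c hc] : a r by exists v.
  pose u := \sum_i c i *: w i.
  have hspan : forall g', g' \in [seq w i | i <- enum 'I_(size ys)] ++ t ->
      lspan ([seq w i | i <- enum 'I_(size ys)] ++ t) g' by move=> ?; apply: mem_lspan.
  have hu : lspan ([seq w i | i <- enum 'I_(size ys)] ++ t) u.
    apply: memsub_sum => i _; apply/memsubZ/hspan; rewrite mem_cat map_f //.
    exact: mem_enum.
  rewrite -[v](subrK u); apply: memsubD => //.
  have : lspan t (v - u).
    apply/ht; split; first by apply: memsubB => //; apply: memsub_sum => i _;
      apply: memsubZ; case: (hw i).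
    rewrite -[v - u](subrKA (r *: g)); apply: memsubD => //.
    rewrite hc scaler_suml -sumrB; apply: memsub_sum => i _.
    by rewrite -scalerA -scalerBr -opprB; apply/memsubZ/memsubN; case: (hw i).
  by apply: lspan_sub => g' hg'; apply: hspan; rewrite mem_cat hg' orbT.
apply: lspan_sub => g'; rewrite mem_cat => /orP[/mapP[i _ ->]|hg'].
  by case: (hw i).
by have [] := (ht g').2 (mem_lspan hg').
Qed.

Lemma fin_gen_subquot V (D1 D2 : submod V) : fin_gen V -> fin_gen (subquot D1 D2).
Proof.
move=> /fin_gen_span[s hs]; have [//|t ht] := @noetherian_submod _ s D1.
have ht1 (i : 'I_(size t)) : D1 t`_i by apply/ht/mem_lspan/mem_nth.
exists (size t), (fun i => sq_mk D2 (ht1 i)) => q; have [v hv] := rep_ex q.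
have /lspanP[c e] := (ht v).1 (rep_mem hv); exists c.
apply: (rep_fun hv); rewrite e.
apply: (big_ind2 (fun q v => rep q v)); first exact: rep00.
- by move=> *; apply: repD.
- by move=> i _; apply/repZ/rep_mk.
Qed.

End FinGen.

Section Summand.
Variables (R : comNzRingType) (N : lmodType R).
Hypothesis noethR : noetherian R.
Implicit Types A B : lmodType R.

(** Finite generation of [B] provides a free cover [Q] of [B] with finitely
    generated kernel [K], hence a sequence [X * K -> Y * Q -> A * B] for every
    sequence [X -> Y -> A]. *)
Lemma ext_zero_summand k A B : fin_gen B ->
  ext_zero N k (A * B)%type -> ext_zero N k A.
Proof.
elim: k A B => [|k IH] A B fgB hA X Y i p hip.
  move=> f; have [i' [p' [hip' e]]] := short_exact_prodr B hip.
  have [g hg] := hA _ _ _ _ hip' f; have [l hl] := prod_inl Y B.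
  by exists (g \o l) => x; rewrite /= hl -e hg.
move=> hY; have [m [c cS]] := fin_gen_cover fgB.
have [j hj] := kernel_exact cS.
have [f hf] := prod_map i j; have [g hg] := prod_map p c.
have hfg := short_exact_prod2 hip hj hf hg.
apply: (IH X (subquot (kernel_sub c) sub_zero)).
  exact/fin_gen_subquot/fin_gen_row.
apply: hA hfg _; apply: ext_zero_prod => //.
exact/ext_zero_projective/projective_row.
Qed.

End Summand.

(** * Comparison with projective resolutions *)

Section Resolutions.
Variables (R : comNzRingType) (N : lmodType R).

Section Shift.
Variables (M : lmodType R) (P : proj_resolution M) (A : lmodType R).
Variables (i : {linear A -> P 0%N}) (e : {linear P 1%N -> A}).
Hypotheses (hi : short_exact i (pr_aug P)) (he : forall u, i (e u) = pr_diff P 0 u).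

Fact shift_surj a : exists u, e u = a.
Proof.
have [iI _ _] := hi.
have /(@pr_exact0 R M P)[w hw] := short_exact0 hi a.
by exists w; apply: iI; rewrite he.
Qed.

Fact shift_exact0 u : e u = 0 <-> exists w, pr_diff P 1 w = u.
Proof.
rewrite -(@pr_exactS R M P) -he; split=> [->|]; first by rewrite linear0.
by have [iI _ _] := hi; rewrite -[in X in X -> _](linear0 i) => /iI.
Qed.

(** Deleting the degree zero term of a resolution of [M] leaves a resolution of
    the first syzygy [A] of [M]. *)
Definition shift_resolution : proj_resolution A :=
  @ProjResolution R A (fun j => P j.+1) (fun j => pr_diff P j.+1) e
    (fun j => @pr_proj R M P j.+1) shift_surj shift_exact0 (fun j => @pr_exactS R M P j.+1).

End Shift.

Lemma shift_exists (M : lmodType R) (P : proj_resolution M) :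
  exists (A : lmodType R) (i : {linear A -> P 0%N}) (e : {linear P 1%N -> A}),
    short_exact i (pr_aug P) /\ forall u, i (e u) = pr_diff P 0 u.
Proof.
have [i hi] := kernel_exact (pr_aug_surj P); have [iI iS iK] := hi.
have [|e he] := factor_inj (h := pr_diff P 0) iI.
  by move=> u; apply/iK/pr_exact0; exists u.
by exists (subquot (kernel_sub (pr_aug P)) sub_zero), i, e.
Qed.

Lemma ext_zero_coboundary k (M : lmodType R) (P : proj_resolution M) :
  ext_zero N k M -> forall f : {linear P k.+1 -> N}, cocycle f -> coboundary f.
Proof.
elim: k M P => [|k IH] M P hM; have [A [i [e [hi he]]]] := shift_exists P.
  move=> f hf; have [|f' hf'] := factor_surj (h := f) (shift_surj hi he).
    by move=> u /(shift_exact0 hi he)[w <-]; apply: hf.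
  have [g hg] := hM _ _ _ _ hi f'; exists g => u.
  by rewrite -he hg hf'.
apply: (IH A (shift_resolution hi he)).
exact: ext_zero_left hi hM (ext_zero_projective _ _ (@pr_proj R M P 0%N)).
Qed.

(** A single resolution suffices to establish [ext_zero]. *)
Lemma coboundary_ext_zero k (M : lmodType R) (P : proj_resolution M) :
  (forall f : {linear P k.+1 -> N}, cocycle f -> coboundary f) -> ext_zero N k M.
Proof.
elim: k M P => [|k IH] M P hP; have [A [i [e [hi he]]]] := shift_exists P.
  apply: (ext_zero_right0 hi); last exact/ext_zero_projective/pr_proj.
  move=> f; have [|g hg] := hP (f \o e).
    move=> u /=; rewrite (_ : e _ = 0) ?linear0 //.
    by apply/(shift_exact0 hi he); exists u.
  by exists g => a; have [u <-] := shift_surj hi he a; rewrite he -hg.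
apply: (ext_zero_right hi); first exact: (IH A (shift_resolution hi he)).
exact/ext_zero_projective/pr_proj.
Qed.

Hypothesis noethR : noetherian R.

(** Resolutions exist: iterate free covers of finite rank. *)
Lemma free_resolution (M : lmodType R) : fin_gen M -> inhabited (proj_resolution M).
Proof.
move=> fgM; pose T := {Z : lmodType R | fin_gen Z}.
have cover (Z : T) : {m : nat & {c : {linear 'rV[R]_m -> sval Z}
    & {i : {linear subquot (kernel_sub c) sub_zero -> 'rV[R]_m} | short_exact i c}}}.
  have [m /cid[c cS]] := cid (fin_gen_cover (svalP Z)).
  by exists m, c; apply/cid/kernel_exact.
pose rk Z := projT1 (cover Z).
pose cov Z : {linear 'rV[R]_(rk Z) -> sval Z} := projT1 (projT2 (cover Z)).
pose next Z : T := exist (fun Z : lmodType R => fin_gen Z) _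
  (fin_gen_subquot noethR (kernel_sub (cov Z)) sub_zero (@fin_gen_row R (rk Z))).
pose inc Z : {linear sval (next Z) -> 'rV[R]_(rk Z)} := sval (projT2 (projT2 (cover Z))).
have hinc Z : short_exact (inc Z) (cov Z) := svalP (projT2 (projT2 (cover Z))).
pose Zs := fix Zs j : T := if j is j'.+1 then next (Zs j') else exist _ M fgM.
have covS Z v : exists u, cov Z u = v by have [_ h _] := hinc Z; apply: h.
have incI Z u : inc Z u = 0 <-> u = 0.
  have [h _ _] := hinc Z; split=> [|->]; rewrite ?linear0 //.
  by rewrite -[in X in X -> _](linear0 (inc Z)) => /h.
have covK Z u : cov Z u = 0 <-> exists w, inc Z (cov (next Z) w) = u.
  have [_ _ h] := hinc Z; rewrite h; split=> [[a <-]|[w <-]]; last by eexists.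
  by have [w <-] := covS _ a; exists w.
constructor.
apply: (@ProjResolution R M (fun j => 'rV[R]_(rk (Zs j)))
  (fun j => inc (Zs j) \o cov (Zs j.+1)) (cov (Zs 0%N))).
- by move=> j; apply: projective_row.
- exact: (covS (Zs 0%N)).
- exact: (covK (Zs 0%N)).
- by move=> j u /=; rewrite incI; apply: (covK (Zs j.+1)).
Qed.

Lemma ext_zeroP k (M : lmodType R) : fin_gen M -> (ext_zero N k M <-> Ext_vanishes k.+1 M N).
Proof.
move=> fgM; split=> [h P|h]; first exact: ext_zero_coboundary.
by have [P] := free_resolution fgM; apply: (coboundary_ext_zero (P := P)); apply: h.
Qed.

End Resolutions.

(** * Nakayama's lemma for Ext *)

(** If [Z = x Z + (Z /\ B)] is finitely generated and every [1 - x c] is a unit,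
    then [Z] is contained in [B]. *)
Lemma nakayama (R : comNzRingType) (V : lmodType R) (Z B : submod V) (x : R) (s : seq V) :
  (forall c, exists u, u * (1 - x * c) = 1) ->
  (forall g, g \in s -> Z g) -> (forall z, Z z -> lspan s z) ->
  (forall z, Z z -> exists2 z', Z z' & B (z - x *: z')) ->
  forall z, Z z -> B z.
Proof.
move=> hx hs hZs hZ; pose D t := foldr (fun g D => sub_adj D g) B t.
have hB t z : B z -> D t z by elim: t => //= g t IH hz; apply: sub_adj_sub; apply: IH.
have hD t z : lspan t z -> D t z.
  elim: t z => [|g t IH] z /=; first by move=> ->; apply: memsub0.
  by move=> [r hr]; exists r; apply: IH.
have {hZs} : forall z, Z z -> D s z by move=> z /hZs/hD.
elim: s hs => [|g s IH] hs hZs //; apply: IH => [g' h|z hz].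
  by apply: hs; rewrite inE h orbT.
have /hZ[z' /hZs[/= c hc] hb] : Z g by apply: hs; rewrite mem_head.
(* The last generator [g] is redundant modulo [B]: [g = x z' + b] gives
   [(1 - x c) g] in [D s], where [c] is the coefficient of [g] in [z']. *)
suff hg : D s g by have [r hr] := hZs z hz; rewrite -[z](subrK (r *: g)); apply/memsubD/memsubZ.
have [u hu] := hx c; rewrite -[g]scale1r -hu -scalerA; apply: memsubZ.
rewrite scalerBl scale1r -scalerA -[_ - _](subrKA (x *: z')).
by apply: memsubD; [apply: hB | rewrite -scalerBr; apply: memsubZ].
Qed.

Lemma fin_gen_ffun (R : comNzRingType) (N : lmodType R) s :
  fin_gen N -> fin_gen ({ffun 'I_s -> N} : lmodType R).
Proof.
move=> [m [g hg]].
apply: (@fin_gen_finType R _ ('I_s * 'I_m)%type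
  (fun ij => [ffun l => if l == ij.1 then g ij.2 else 0])) => v.
have [c hc] := choice (fun i => hg (v i)); exists (fun ij => c ij.1 ij.2).
apply/ffunP => l; rewrite sum_ffunE hc.
rewrite -(pair_bigA_idem _ (fun i j =>
  (c i j *: [ffun l => if l == i then g j else 0] : {ffun _ -> N}) l)) /=; last by rewrite addr0.
rewrite (bigD1 l) //= [X in _ + X]big1 ?addr0 => [|i /negPf hi].
  by apply: eq_bigr => j _; rewrite !ffunE eqxx.
by rewrite big1 // => j _; rewrite !ffunE eq_sym hi scaler0.
Qed.

Section Nakayama.
Variables (R : comNzRingType) (N : lmodType R).
Implicit Types A C K P : lmodType R.

(** Multiplication by [x] is onto [Ext^(k+1) (A, N)], the latter being computed
    by free covers. *)
Fixpoint ext_div (k : nat) (x : R) (A : lmodType R) : Prop :=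
  match k with
  | 0%N => forall m K (j : {linear K -> 'rV[R]_m}) (c : {linear 'rV[R]_m -> A}),
      short_exact j c -> forall f : {linear K -> N},
      exists (f' : {linear K -> N}) (g : {linear 'rV[R]_m -> N}),
        forall a, f a = x *: f' a + g (j a)
  | k'.+1 => forall m K (j : {linear K -> 'rV[R]_m}) (c : {linear 'rV[R]_m -> A}),
      short_exact j c -> ext_div k' x K
  end.

(** Let [C] be the cokernel of the embedding [a |-> (x a, iota a)] of [A] into
    [A * P], and let [K] be the kernel of a free cover [F] of [A].  Then the kernel
    [W] of [F * P -> C] is the cokernel of the embedding [b |-> (x b, j b)] of [K]
    into [K * F]. *)
Lemma cone_syzygy x A P C K m (iota : {linear A -> P}) (q : {linear (A * P)%type -> C})
    (j : {linear K -> 'rV[R]_m}) (c : {linear 'rV[R]_m -> A}) :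
  (forall d, exists u, q u = d) ->
  (forall u, q u = 0 <-> exists a, u = (x *: a, iota a)) ->
  (forall a, x *: a = 0 -> iota a = 0 -> a = 0) ->
  short_exact j c ->
  exists (W : lmodType R) (w : {linear W -> ('rV[R]_m * P)%type})
    (s : {linear ('rV[R]_m * P)%type -> C}) (theta : {linear (K * 'rV[R]_m)%type -> W}),
    [/\ short_exact w s, forall z, exists u, theta u = z
      & forall u, theta u = 0 <-> exists b, u = (x *: b, j b)].
Proof.
move=> qS qK inj hjc; have [jI cS cK] := hjc.
have [phi hphi] := prod_map c (idfun : {linear P -> P}).
have qphiS d : exists u, (q \o phi) u = d.
  by have [[a p] <-] := qS d; have [r <-] := cS a; exists (r, p); rewrite /= hphi.
have [w hw] := kernel_exact qphiS; have [wI _ wK] := hw.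
have [theta0 htheta0] : exists t : {linear (K * 'rV[R]_m)%type -> ('rV[R]_m * P)%type},
    forall u, t u = (x *: u.2 - j u.1, iota (c u.2)).
  apply: linear_exists => r u v; congr pair; last by rewrite /= !linearP.
  by rewrite /= (linearP j) scalerDr !scalerA mulrC -scalerA opprD addrACA -scalerBr.
have [|theta htheta] := factor_inj (h := theta0) wI.
  move=> [b f]; apply/wK; rewrite /= hphi htheta0 /=; apply/qK; exists (c f).
  by rewrite linearB linearZ /= (short_exact0 hjc) subr0.
exists (subquot (kernel_sub (q \o phi)) sub_zero), w, (q \o phi), theta; split=> //.
- move=> z; have /qK[a] : (q \o phi) (w z) = 0 by apply/wK; exists z.
  rewrite hphi /= => -[e1 e2]; have [f hf] := cS a.
  have /cK[b hb] : c (x *: f - (w z).1) = 0 by rewrite linearB linearZ /= hf e1 subrr.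
  exists (b, f); apply: wI; rewrite htheta htheta0 /= hb hf -e2 opprB addrC subrK.
  by rewrite -surjective_pairing.
- move=> [b f]; split=> [e|[b' [-> ->]]].
    have := htheta (b, f); rewrite e linear0 htheta0 /= => -[/esym/eqP e1 /esym e2].
    have {}e1 : x *: f = j b by apply/eqP; rewrite -subr_eq0.
    have /cK[b' hb'] : c f = 0.
      by apply: inj => //; rewrite -linearZ /= e1 (short_exact0 hjc).
    by exists b'; congr pair => //; apply: jI; rewrite -e1 -hb' linearZ.
  apply: wI; rewrite htheta htheta0 linear0 /= linearZ /= subrr.
  by rewrite (short_exact0 hjc) linear0.
Qed.

(** The exactness of [Ext^(k+1) A -> Ext^(k+1) A -> Ext^(k+2) C], the first map
    being multiplication by [x], for [C] the cone of [x] and [iota]: a form of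
    the statement that passes to syzygies. *)
Lemma ext_div_cone k x A P C (iota : {linear A -> P}) (q : {linear (A * P)%type -> C}) :
  projective P -> (forall c, exists u, q u = c) ->
  (forall u, q u = 0 <-> exists a, u = (x *: a, iota a)) ->
  (forall a, x *: a = 0 -> iota a = 0 -> a = 0) ->
  ext_zero N k.+1 C -> ext_div k x A.
Proof.
elim: k x A P C iota q => [|k IH] x A P C iota q projP qS qK inj hC m K j c hjc;
  have [W [w [s [theta [hw thetaS thetaK]]]]] := cone_syzygy qS qK inj hjc;
  have [jI cS cK] := hjc;
  have hW : ext_zero N _ W := ext_zero_left hw hC (ext_zero_prod
   (ext_zero_projective _ _ (@projective_row R m)) (ext_zero_projective _ _ projP)).
- move=> f; have [beta hbeta] : exists b : {linear K -> (K * 'rV[R]_m)%type},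
      forall a, b a = (x *: a, j a).
    apply: linear_exists => r u v; congr pair; last by rewrite /= linearP.
    by rewrite /= scalerDr !scalerA mulrC.
  have [|h hh] := hW _ _ beta theta _ f.
    split=> // [a a'|u]; first by rewrite !hbeta => -[_ /jI].
    by rewrite thetaK; split=> -[a]; [move=> ->; exists a | move=> <-; exists a].
  have [l hl] := prod_inl K 'rV[R]_m; have [r hr] := prod_inr K 'rV[R]_m.
  exists (h \o l), (h \o r) => a; rewrite /= hl hr -linearZ -linearD -hh hbeta.
  by congr (h _); congr pair; rewrite /= ?scaler0 ?addr0 ?add0r.
- apply: (IH x K 'rV[R]_m _ j theta) => //; first exact: projective_row.
  by move=> a _ e; apply: jI; rewrite e linear0.
Qed.

Hypothesis noethR : noetherian R.
Hypothesis fgN : fin_gen N.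

(** Nakayama's lemma for [Ext^(k+1) (A, N)].  For [k = 0], a map from the first
    syzygy [K] to [N] is recorded by its values on generators of [K]. *)
Lemma ext_div_zero k x A0 : (forall c, exists u, u * (1 - x * c) = 1) ->
  fin_gen A0 -> ext_div k x A0 -> ext_zero N k A0.
Proof.
have cover A : fin_gen A -> exists (m : nat) (K : lmodType R)
    (j : {linear K -> 'rV[R]_m}) (c : {linear 'rV[R]_m -> A}), short_exact j c /\ fin_gen K.
  move=> /fin_gen_cover[m [c cS]]; have [j hj] := kernel_exact cS.
  exists m, (subquot (kernel_sub c) sub_zero), j, c; split=> //.
  exact/fin_gen_subquot/fin_gen_row.
move=> hx; elim: k A0 => [|k IH] A /cover[m [K [j [c [hj fgK]]]]] hA.
- apply: (ext_zero_right0 hj); last exact/ext_zero_projective/projective_row.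
  have [s [e he]] := fgK; pose V : lmodType R := {ffun 'I_s -> N}.
  pose restr (L : lmodType R) (h : {linear K -> L}) (v : V) :=
    exists f : {linear L -> N}, forall i, v i = f (h (e i)).
  have restr0 L h : @restr L h 0 by exists \0 => i; rewrite !ffunE.
  have restrP L h r u v : @restr L h u -> restr L h v -> restr L h (r *: u + v).
    move=> [f hf] [g hg]; exists ((r \*: f) \+ g) => i; by rewrite !ffunE hf hg.
  pose Z := Submod (restr0 K idfun) (@restrP K idfun).
  pose B := Submod (restr0 _ j) (@restrP _ j).
  have /fin_gen_span[t0 ht0] : fin_gen V by apply: fin_gen_ffun.
  have [//|t ht] := @noetherian_submod R noethR V t0 Z.
  have key : forall z, Z z -> B z.
    apply: (@nakayama R V Z B x t) => //.
    - by move=> g hg; apply/ht/mem_lspan.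
    - by move=> z /ht.
    - move=> z [f hf]; have [f' [g hg]] := hA _ _ _ _ hj f.
      exists [ffun i => f' (e i)]; first by exists f' => i; rewrite ffunE.
      by exists g => i; rewrite !ffunE hf hg addrC addKr.
  move=> f; have [|g hg] := key [ffun i => f (e i)]; first by exists f => i; rewrite ffunE.
  exists g => a; have [r ->] := he a; rewrite !linear_sum.
  by apply: eq_bigr => i _; rewrite !linearZ /= -hg ffunE.
- apply: (ext_zero_right hj); first by apply: IH => //; apply: hA hj.
  exact/ext_zero_projective/projective_row.
Qed.

(** If [x] is [A]-regular and lies in the Jacobson radical, then
    [Ext^(k+2) (A / x A, N) = 0] implies [Ext^(k+1) (A, N) = 0]. *)
Lemma ext_zero_div k x A C (p : {linear A -> C}) :
  (forall c, exists u, u * (1 - x * c) = 1) -> fin_gen A ->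
  (forall a : A, x *: a = 0 -> a = 0) -> (forall c, exists a, p a = c) ->
  (forall a, p a = 0 <-> exists b : A, a = x *: b) ->
  ext_zero N k.+1 C -> ext_zero N k A.
Proof.
move=> hx fgA xreg pS pK hC; apply: (ext_div_zero hx fgA).
apply: (@ext_div_cone k x A 'rV[R]_0 C (\0 : {linear A -> 'rV[R]_0})
  (p \o fst : {linear (A * 'rV[R]_0)%type -> C})) => //; first exact: projective_row.
- by move=> c; have [a <-] := pS c; exists (a, 0).
- move=> [a r] /=; rewrite pK; split=> -[b]; last by move=> [-> _]; exists b.
  by move=> ->; exists b; congr pair; apply: thinmx0.
- by move=> a /xreg.
Qed.

End Nakayama.

(** * Maps between subquotients *)

Section SubquotientMaps.
Variable R : comNzRingType.
Implicit Types V W : lmodType R.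

Lemma sq_map V W (h : {linear V -> W}) (D1 D2 : submod V) (E1 E2 : submod W) :
  (forall v, D1 v -> E1 (h v)) -> (forall v, D1 v -> D2 v -> E2 (h v)) ->
  exists f : {linear subquot D1 D2 -> subquot E1 E2},
    forall q v, rep q v -> rep (f q) (h v).
Proof.
move=> h1 h2.
have [|||f hf] := @linear_of_graph R (subquot D1 D2) (subquot E1 E2)
    (fun q q' => exists2 v, rep q v & rep q' (h v)).
- move=> q; have [v hv] := rep_ex q.
  by have [q' hq'] := rep_cls E2 (h1 v (rep_mem hv)); exists q', v.
- move=> q a b [v hv ha] [v' hv' hb]; apply: rep_eqP ha hb _; rewrite -linearB.
  by apply: h2; [apply: memsubB (rep_mem hv) (rep_mem hv') | apply: rep_inj hv hv'].
- move=> r a b a' b' [v hv hb] [v' hv' hb']; exists (r *: v + v'); first exact: rep_lin.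
  by rewrite linearP; apply: rep_lin.
exists f => q v hv; have [v' hv' hf'] := hf q.
split; first exact/h1/(rep_mem hv).
rewrite -(subrKA (h v')); apply: memsubD; last by case: hf'.
rewrite -linearB; apply: h2; last exact: rep_inj hv hv'.
exact: memsubB (rep_mem hv) (rep_mem hv').
Qed.

Lemma sq_iso V W (h : {linear V -> W}) (D1 D2 : submod V) (E1 E2 : submod W) :
  (forall v, D1 v -> E1 (h v)) -> (forall v, D1 v -> (E2 (h v) <-> D2 v)) ->
  (forall w, E1 w -> exists2 v, D1 v & E2 (w - h v)) ->
  exists f : {linear subquot D1 D2 -> subquot E1 E2},
    (forall b, exists a, f a = b) /\ injective f.
Proof.
move=> h1 h2 h3; have [|f hf] := sq_map (D2 := D2) (E2 := E2) h1.
  by move=> v hv; rewrite h2.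
exists f; split.
  move=> b; have [w hw] := rep_ex b; have [v hv e] := h3 w (rep_mem hw).
  have [q hq] := rep_cls D2 hv; exists q; apply/esym.
  exact: rep_eqP hw (hf _ _ hq) e.
apply: linear_inj0 => q; have [v hv] := rep_ex q.
by move=> /(rep0 (hf _ _ hv)) e; apply/(rep0 hv)/h2 => //; apply: rep_mem hv.
Qed.

Lemma sq_ses V (D1 D2 D3 : submod V) :
  (forall v, D3 v -> D2 v) -> (forall v, D2 v -> D1 v) ->
  exists (i : {linear subquot D2 D3 -> subquot D1 D3})
    (p : {linear subquot D1 D3 -> subquot D1 D2}),
  short_exact i p /\ forall q v, rep q v -> rep (p q) v.
Proof.
move=> h32 h21; have [||i hi] := @sq_map V V idfun D2 D3 D1 D3 => //.
have [||p hp] := @sq_map V V idfun D1 D3 D1 D2; [by []|by move=> v _; apply: h32|].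
exists i, p; split=> //; split.
- apply: linear_inj0 => q; have [v hv] := rep_ex q.
  by move=> /(rep0 (hi _ _ hv)) e; apply/(rep0 hv).
- move=> c; have [v hv] := rep_ex c; have [q hq] := rep_cls D3 (rep_mem hv).
  by exists q; apply: rep_fun (hp _ _ hq) hv.
- move=> b; have [v hv] := rep_ex b; rewrite (rep0 (hp _ _ hv)) /=; split=> [e|[a]].
    by have [a ha] := rep_cls D3 e; exists a; apply: rep_fun (hi _ _ ha) hv.
  have [w hw] := rep_ex a => e; have := hi _ _ hw; rewrite {}e /= => hw'.
  rewrite -[v](subrK w); apply: memsubD (rep_mem hw).
  exact/h32/(rep_inj hv hw').
Qed.

Lemma sq_top_iso V : exists f : {linear subquot (sub_top : submod V) sub_zero -> V},
  (forall b, exists a, f a = b) /\ injective f.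
Proof.
by have [i [iI iS _]] := sub_incl (sub_top : submod V); exists i; split=> // b; apply/iS.
Qed.

End SubquotientMaps.

Section SubquotientExt.
Variables (R : comNzRingType) (N : lmodType R).
Hypothesis noethR : noetherian R.
Implicit Types V W : lmodType R.

(** [h] induces an isomorphism [D1 / D2 -> E1 / E2]. *)
Lemma ext_zero_sq k V W (h : {linear V -> W}) (D1 D2 : submod V) (E1 E2 : submod W) :
  (forall v, D1 v -> E1 (h v)) -> (forall v, D1 v -> (E2 (h v) <-> D2 v)) ->
  (forall w, E1 w -> exists2 v, D1 v & E2 (w - h v)) ->
  ext_zero N k (subquot D1 D2) <-> ext_zero N k (subquot E1 E2).
Proof.
move=> h1 h2 h3; have [f [fS fI]] := sq_iso h1 h2 h3.
by split; [apply: ext_zero_iso fS fI | apply: ext_zero_inv fS fI].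
Qed.

(** The map [D1 / D2 -> E1 / E2] induced by [h] is a split embedding, with
    complement [(E1 /\ E') / E2]. *)
Lemma ext_zero_sq_summand k V W (h : {linear V -> W}) (D1 D2 : submod V)
    (E1 E2 E' : submod W) :
  fin_gen W ->
  (forall v, D1 v -> E1 (h v)) -> (forall v, D1 v -> D2 v -> E2 (h v)) ->
  (forall w, E2 w -> E' w) ->
  (forall w, E1 w -> exists2 v, D1 v & E' (w - h v)) ->
  (forall v, D1 v -> E' (h v) -> D2 v) ->
  ext_zero N k (subquot E1 E2) -> ext_zero N k (subquot D1 D2).
Proof.
move=> fgW h1 h2 h3 h4 h5 hE.
have [f hf] := sq_map (D2 := D2) (E2 := E2) h1 h2.
have [||g hg] := @sq_map R W W idfun (sub_cap E1 E') E2 E1 E2; [by move=> w []|by []|].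
apply: (ext_zero_summand noethR (fin_gen_subquot noethR (sub_cap E1 E') E2 fgW)).
have [s hs] : exists s : {linear (subquot D1 D2 * subquot (sub_cap E1 E') E2)%type ->
    subquot E1 E2}, forall u, s u = f u.1 + g u.2.
  by exists ((f \o fst) \+ (g \o snd)).
have hrep a b v w : rep a v -> rep b w -> rep (s (a, b)) (h v + w).
  by move=> ha hb; rewrite hs /=; apply: repD; [apply: hf | apply: hg].
apply: (ext_zero_inv (g := s)) hE.
  move=> c; have [w hw] := rep_ex c; have [v hv e] := h4 w (rep_mem hw).
  have [a ha] := rep_cls D2 hv.
  have hv' : sub_cap E1 E' (w - h v).
    by split=> //; apply: memsubB; [apply: rep_mem hw | apply: h1].
  have [b hb] := rep_cls E2 hv'.
  by exists (a, b); apply: rep_fun (hrep _ _ _ _ ha hb) _; rewrite addrC subrK.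
apply: linear_inj0 => -[a b]; have [v hv] := rep_ex a; have [w hw] := rep_ex b.
move=> /(rep0 (hrep _ _ _ _ hv hw)) e; have [_ hw'] := rep_mem hw.
have ev : D2 v.
  apply: h5; first exact: rep_mem hv.
  by rewrite -[h v](addrK w); apply: memsubB => //; apply: h3.
congr pair; first exact/(rep0 hv).
apply/(rep0 hw); rewrite -[w](addKr (h v)) addrC; apply: memsubB => //.
by apply: h2 => //; apply: rep_mem hv.
Qed.

Lemma ext_zero_trivial k V : (forall v : V, v = 0) -> ext_zero N k V.
Proof.
move=> h; apply: (@ext_zero_iso R N k 'rV[R]_0 V \0).
- by move=> v; exists 0; rewrite [v]h.
- by move=> u v _; rewrite (thinmx0 u) (thinmx0 v).
- exact/ext_zero_projective/projective_row.
Qed.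

Lemma ext_zero_top k V : ext_zero N k (subquot (sub_top : submod V) sub_zero) <-> ext_zero N k V.
Proof.
have [f [fS fI]] := sq_top_iso V.
by split; [apply: ext_zero_iso fS fI | apply: ext_zero_inv fS fI].
Qed.

End SubquotientExt.

(** * Reduction to the residue field *)

Section Bass.
Variables (R : comNzRingType) (N : lmodType R).
Hypothesis noethR : noetherian R.
Implicit Types a b : submod R^o.

(** Noetherian induction on ideals. *)
Lemma noetherian_ideal_ind (P : submod R^o -> Prop) :
  (forall a, (forall b : submod R^o, (forall r, a r -> b r) ->
     (exists2 r, b r & ~ a r) -> P b) -> P a) ->
  forall a, P a.
Proof.
move=> step a0; apply: contrapT => na0.
have ex (a : {a | ~ P a}) : exists b : {a | ~ P a},
    (forall r, sval a r -> sval b r) /\ (exists2 r, sval b r & ~ sval a r).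
  case: a => a na /=; apply: contrapT => hn; apply: na; apply: step => b hab hba.
  by apply: contrapT => nb; apply: hn; exists (exist _ b nb).
have [next hnext] := choice ex.
pose s n : submod R^o := sval (iter n next (exist _ a0 na0)).
have sS n r : s n r -> s n.+1 r.
  by have [h _] := hnext (iter n next (exist _ a0 na0)); apply: h.
have sle n m r : (n <= m)%N -> s n r -> s m r.
  by move=> /subnK <-; elim: (m - n)%N => // d IH h; apply/sS/IH.
have [|xs hxs] := noethR (I := fun r => exists n, s n r).
  split.
  - by exists 0%N; apply: memsub0.
  - move=> r r' [n h] [m h']; exists (maxn n m); apply: memsubD.
      by apply: sle h; apply: leq_maxl.
    by apply: sle h'; apply: leq_maxr.
  - by move=> r r' [n h]; exists n; apply: (memsubZ (V := R^o)).
have hx (i : 'I_(size xs)) : exists n, s n xs`_i.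
  apply/hxs; exists (fun j => (j == i)%:R); rewrite (bigD1 i) //= eqxx mul1r.
  by rewrite big1 ?addr0 // => j /negPf ->; rewrite mul0r.
have [f hf] := choice hx; pose m := (\max_i f i)%N.
have [_ [r hr hr']] := hnext (iter m next (exist _ a0 na0)); apply: hr'.
have /hxs[c ->] : exists n, s n r by exists m.+1.
apply: (memsub_sum (V := R^o)) => i _; apply: (memsubZ (V := R^o)).
by apply: sle (hf i); apply: leq_bigmax.
Qed.

Hypothesis fgN : fin_gen N.
Variable m : submod R^o.
Hypothesis unit_m : forall r, ~ m r -> exists u, u * r = 1.
Hypothesis proper_m : ~ m 1.

Lemma jacobson_unit x : m x -> forall c, exists u, u * (1 - x * c) = 1.
Proof.
move=> hx c; apply: unit_m => h; apply: proper_m.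
by rewrite -[1](subrK (x * c)) mulrC; apply: memsubD; [rewrite mulrC | apply: memsubZ].
Qed.

(** If [Ext^i (R/m, N) = 0] for all [i > c], then [Ext^i (R/a, N) = 0] for all
    ideals [a] and all [i > c], by Noetherian induction on [a].  Take [x] in [m] and
    not in [a].  If [x] is regular on [R/a], then Nakayama applies to
    [R/a -> R/a -> R/(a + (x))].  Otherwise [x y] is in [a] for some [y] not in
    [a], and [R/a] is an extension of [R/(a + (y))] by [R/(a : y)]. *)
Lemma ext_zero_cyclic c :
  (forall k, (c <= k)%N -> ext_zero N k (subquot (sub_top : submod R^o) m)) ->
  forall a k, (c <= k)%N -> ext_zero N k (subquot (sub_top : submod R^o) a).
Proof.
move=> hm; apply: noetherian_ideal_ind => a IH k hk.
have [a1|na1] := pselect (a 1).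
  apply: ext_zero_trivial => q; have [v hv] := rep_ex q; apply/(rep0 hv).
  by rewrite -[v]mulr1; apply: (memsubZ (V := R^o)).
have [hma|] := pselect (forall x, m x -> a x).
  apply/(ext_zero_sq N k (h := idfun : {linear R^o -> R^o}) (E1 := sub_top) (E2 := m)
           (D1 := sub_top) (D2 := a)) => //.
  - move=> v _ /=; split=> // hv; first exact: hma.
    apply: contrapT => /unit_m[u hu]; apply: na1; rewrite -hu.
    exact: (memsubZ (V := R^o)).
  - by move=> w _; exists w => //=; rewrite subrr; apply: memsub0.
  - exact: hm.
move=> /existsNP[x /not_implyP[mx nax]].
have [reg|] := pselect (forall r, a (x * r) -> a r).
  have [|i [p [[_ pS _] hp]]] := @sq_ses R R^o sub_top (sub_adj a x) a (@sub_adj_sub R R^o a x).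
    by [].
  have hscale (q : subquot (sub_top : submod R^o) a) r : rep q r -> rep ((x : R) *: q) (x * r).
    exact: repZ.
  apply: (ext_zero_div noethR fgN (jacobson_unit mx) _ _ pS).
  - exact/fin_gen_subquot/fin_gen_regular.
  - move=> q; have [r hr] := rep_ex q => /(rep0 (hscale _ _ hr)) /reg e.
    exact/(rep0 hr).
  - move=> q; have [r hr] := rep_ex q; rewrite (rep0 (hp _ _ hr)); split.
      move=> [d hd]; have [q' hq'] := @rep_cls R R^o sub_top a d Logic.I; exists q'.
      by apply: rep_eqP hr (hscale _ _ hq') _; rewrite mulrC.
    move=> [q' eq']; have [d hd] := rep_ex q'; exists d.
    have := hscale _ _ hd; rewrite -eq' => hr'.
    by rewrite /= [d *: _]mulrC; apply: rep_inj hr hr'.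
  - apply: IH; [exact: sub_adj_sub | by exists x => //; apply: sub_adj_gen | exact: leqW].
move=> /existsNP[y /not_implyP[axy nay]].
have [h hh] : exists h : {linear R^o -> R^o}, forall r, h r = r * y.
  by apply: linear_exists => r u v; rewrite mulrDl -mulrA.
have [|i [p [hip _]]] := @sq_ses R R^o sub_top (sub_adj a y) a (@sub_adj_sub R R^o a y).
  by [].
apply: (ext_zero_mid hip).
  apply/(ext_zero_sq N k (h := h) (E1 := sub_adj a y) (E2 := a)
           (D1 := sub_top) (D2 := comap h a)) => //.
  - by move=> r _; exists r; rewrite hh subrr; apply: memsub0.
  - by move=> w [r hr]; exists r => //; rewrite hh.
  - apply: IH => // [r ar /=|]; first by rewrite hh mulrC; apply: (memsubZ (V := R^o)).
    by exists x => //=; rewrite hh.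
apply: IH => //; [exact: sub_adj_sub | by exists y => //; apply: sub_adj_gen].
Qed.

(** Every finitely generated module has a finite filtration with cyclic
    quotients. *)
Lemma ext_zero_residue c :
  (forall k, (c <= k)%N -> ext_zero N k (subquot (sub_top : submod R^o) m)) ->
  forall (M : lmodType R) k, fin_gen M -> (c <= k)%N -> ext_zero N k M.
Proof.
move=> hm M k /fin_gen_span[s hs] hk.
have key t : ext_zero N k (subquot (lspan t : submod M) sub_zero).
  elim: t => [|g t IH].
    by apply: ext_zero_trivial => q; have [v hv] := rep_ex q; apply/(rep0 hv)/(rep_mem hv).
  have [||i [p [hip _]]] := @sq_ses R M (lspan (g :: t)) (lspan t) sub_zero.
  - by move=> v ->; apply: memsub0.
  - by move=> v hv; apply: sub_adj_sub.
  apply: (ext_zero_mid hip IH).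
  have [h hh] := scale_linear g.
  apply/(ext_zero_sq N k (h := h) (E1 := lspan (g :: t)) (E2 := lspan t)
           (D1 := sub_top) (D2 := comap h (lspan t))) => //.
  - by move=> r _; exists r; rewrite hh subrr; apply: memsub0.
  - by move=> w [r hr]; exists r => //; rewrite hh.
  - exact: (ext_zero_cyclic hm).
apply/ext_zero_top.
apply/(ext_zero_sq N k (h := idfun : {linear M -> M}) (E1 := sub_top) (E2 := sub_zero)
         (D1 := lspan s) (D2 := sub_zero)) => //.
by move=> w _; exists w; rewrite ?subrr.
Qed.

End Bass.

(** * Regular sequences *)

Section RegularSequences.
Variables (R : comNzRingType) (x : nat -> R).
Implicit Types A B C V W : lmodType R.

(** The submodule [D + r V]. *)
Section AddMul.
Variables (V : lmodType R) (D : submod V) (r : R).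
Fact add_mul0 : exists w, D (0 - r *: w).
Proof. by exists 0; rewrite scaler0 subr0; apply: memsub0. Qed.
Fact add_mulP c u v : (exists w, D (u - r *: w)) -> (exists w, D (v - r *: w)) ->
  exists w, D ((c *: u + v) - r *: w).
Proof.
move=> [w hw] [w' hw']; exists (c *: w + w').
have -> : c *: u + v - r *: (c *: w + w') = c *: (u - r *: w) + (v - r *: w').
  by rewrite scalerDr scalerBr !scalerA mulrC opprD addrACA.
exact: memsubP.
Qed.
Definition add_mul : submod V := Submod add_mul0 add_mulP.
End AddMul.

(** [(x_0, ..., x_(j-1)) V]. *)
Fixpoint xmul V (j : nat) : submod V :=
  if j is j'.+1 then add_mul (xmul V j') (x j') else sub_zero.

(** The first [j] terms of [x] form a weakly regular sequence on [V]; the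
    condition [V <> (x) V] is not part of this. *)
Definition wreg V (j : nat) : Prop :=
  forall i, (i < j)%N -> forall v : V, xmul V i (x i *: v) -> xmul V i v.

Lemma xmulS V j v : xmul V j v -> xmul V j.+1 v.
Proof. by move=> h; exists 0; rewrite scaler0 subr0. Qed.

Lemma xmul_mem i j : (i < j)%N -> xmul R^o j (x i).
Proof.
elim: j => // j IH; rewrite ltnS leq_eqVlt => /orP[/eqP->|/IH]; last exact: xmulS.
by exists 1; rewrite [_ *: _]mulr1 subrr; apply: memsub0.
Qed.

Lemma xmul_map V W (h : {linear V -> W}) j v : xmul V j v -> xmul W j (h v).
Proof.
elim: j v => [|j IH] v /=; first by move=> ->; rewrite linear0.
by move=> [w /IH hw]; exists (h w); rewrite linearB linearZ in hw.
Qed.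

Lemma xmul_lift V W (h : {linear V -> W}) j w : (forall w, exists v, h v = w) ->
  xmul W j w -> exists2 v, xmul V j v & h v = w.
Proof.
move=> hS; elim: j w => [|j IH] w /=; first by move=> ->; exists 0; rewrite ?linear0.
move=> [w' /IH[v hv ev]]; have [v' ev'] := hS w'.
exists (v + x j *: v'); first by exists v'; rewrite addrK.
by rewrite linearD linearZ /= ev ev' subrK.
Qed.

Lemma wreg_le V i j : (i <= j)%N -> wreg V j -> wreg V i.
Proof. by move=> hij h l hl; apply: h; apply: leq_trans hij. Qed.

(** [A / (x) A -> B / (x) B] is injective, as [Tor_1 (R/(x), C) = 0]. *)
Lemma xmul_exact A B C (i : {linear A -> B}) (p : {linear B -> C}) j a :
  short_exact i p -> wreg C j -> xmul B j (i a) -> xmul A j a.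
Proof.
move=> hip; have [iI pS pK] := hip.
elim: j a => [|j IH] a hC /=; first by rewrite -[X in _ = X -> _](linear0 i) => /iI.
move=> [b hb]; have {}IH := IH _ (wreg_le (leqnSn j) hC).
have := xmul_map p hb; rewrite linearB linearZ /= (short_exact0 hip) sub0r => /memsubN.
rewrite opprK => /(hC j (ltnSn j)) /(xmul_lift pS)[b' hb' eb'].
have /pK[a' ea'] : p (b - b') = 0 by rewrite linearB /= eb' subrr.
exists a'; apply: IH; rewrite linearB linearZ /= ea'.
by rewrite scalerBr opprB addrA addrAC; apply: memsubD => //; apply: memsubZ.
Qed.

Lemma wreg_left A B C (i : {linear A -> B}) (p : {linear B -> C}) j :
  short_exact i p -> wreg B j -> wreg C j.-1 -> wreg A j.
Proof.
move=> hip hB hC l hl a ha; apply: (xmul_exact hip).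
  by apply: wreg_le hC; case: j hl {hB}.
by apply: hB => //; rewrite -linearZ; apply: xmul_map.
Qed.

Lemma row_mem b (D : submod 'rV[R]_b) (v : 'rV[R]_b) :
  (forall l, D (v 0 l *: delta_mx 0 l)) -> D v.
Proof. by move=> h; rewrite [v]row_sum_delta; apply: memsub_sum. Qed.

Lemma xmul_row b j (v : 'rV[R]_b) :
  xmul 'rV[R]_b j v <-> forall l, xmul R^o j (v 0 l).
Proof.
split=> [h l|h].
  by have [f hf] := coord_linear R l; rewrite -hf; apply: xmul_map.
apply: row_mem => l; have [f hf] := scale_linear (delta_mx 0 l : 'rV[R]_b).
by rewrite -hf; apply: xmul_map.
Qed.

Lemma wreg_row b j : wreg R^o j -> wreg 'rV[R]_b j.
Proof.
move=> h i hi v /xmul_row hv; apply/xmul_row => l; apply: h => //.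
by have := hv l; rewrite mxE.
Qed.

(** Nakayama's lemma for the ideal generated by the first [j] terms of [x]. *)
Lemma xmul_zero V j : (forall i, (i < j)%N -> forall c, exists u, u * (1 - x i * c) = 1) ->
  fin_gen V -> (forall v, xmul V j v) -> forall v : V, v = 0.
Proof.
move=> hx fgV; elim: j hx => [|j IH] hx hV v; first exact: hV.
apply: IH => [i hi|w]; first by apply: hx; apply: ltnW.
have /fin_gen_span[s hs] := fgV.
apply: (@nakayama R V sub_top (xmul V j) (x j) s (hx _ (ltnSn _))) => // z _.
by have [z' hz'] := hV z; exists z'.
Qed.

(** Each quotient by a regular element costs one degree. *)
Lemma ext_zero_xmul (N : lmodType R) V j k0 :
  wreg V j -> (forall k, (k0 <= k)%N -> ext_zero N k V) ->
  forall k, (k0 + j <= k)%N -> ext_zero N k (subquot (sub_top : submod V) (xmul V j)).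
Proof.
elim: j => [|j IH] hj hV k hk.
  by apply/ext_zero_top/hV; rewrite addn0 in hk.
case: k hk => [|k]; rewrite addnS ?ltn0 ?ltnS // => hk.
have {}IH := IH (wreg_le (leqnSn j) hj) hV.
have [||p hp] := @sq_map R V V idfun sub_top (xmul V j) sub_top (xmul V j.+1).
- by [].
- by move=> v _; apply: xmulS.
set Q := subquot _ (xmul V j) in p hp IH *.
apply: (@ext_zero_right R N k Q Q _ ( *:%R (x j) : {linear Q -> Q}) p).
- split.
  + apply: linear_inj0 => q; have [v hv] := rep_ex q => /(rep0 (repZ (x j) hv)) h.
    by apply/(rep0 hv)/(hj j).
  + move=> c; have [v hv] := rep_ex c; have [q hq] := @rep_cls R V sub_top (xmul V j) v Logic.I.
    by exists q; apply: rep_fun (hp _ _ hq) hv.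
  + move=> b; have [v hv] := rep_ex b; rewrite (rep0 (hp _ _ hv)) /=; split=> [[w hw]|[a eb]].
      have [q hq] := @rep_cls R V sub_top (xmul V j) w Logic.I; exists q; apply/esym.
      exact: rep_eqP hv (repZ _ hq) hw.
    have [w hw] := rep_ex a; exists w; rewrite -eb in hv.
    exact: rep_inj hv (repZ _ hw).
- exact: IH.
- by apply: IH; apply: leqW.
Qed.

Lemma xmul_ideal (xs : seq R) j (r : R) : (forall i, (i < j)%N -> x i = xs`_i) ->
  (j <= size xs)%N -> (xmul R^o j r <-> ideal_gen (take j xs) r).
Proof.
move=> hx; elim: j r hx => [|j IH] r hx hj.
  rewrite take0; split=> [->|[c ->]]; first by exists (fun=> 0); rewrite big_ord0.
  by rewrite big_ord0.
have {}IH r' := IH r' (fun i h => hx i (ltnW h)) (ltnW hj).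
have gen y : ideal_gen (rcons (take j xs) xs`_j) y <->
    exists w, ideal_gen (take j xs) (y - xs`_j * w).
  rewrite /ideal_gen size_rcons; split=> [[c ->]|[w [c hc]]].
    exists (c ord_max), (fun i => c (widen_ord (leqnSn _) i)).
    rewrite big_ord_recr /= nth_rcons ltnn eqxx mulrC addrK.
    by apply: eq_bigr => i _; rewrite nth_rcons ltn_ord.
  exists (fun i => if insub (val i) is Some i' then c i' else w).
  rewrite big_ord_recr /= nth_rcons ltnn eqxx insubF ?ltnn //.
  rewrite -[LHS](subrK (xs`_j * w)) hc [w * _]mulrC; congr (_ + _).
  by apply: eq_bigr => i _; rewrite nth_rcons ltn_ord /= valK.
rewrite (take_nth 0 hj) gen -(hx j (ltnSn j)).
by split=> -[w hw]; exists w; apply/IH.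
Qed.

End RegularSequences.

(** * Minimal covers and syzygies *)

Section Syzygies.
Variables (R : comNzRingType) (N : lmodType R).
Hypothesis noethR : noetherian R.

(** A cover by a free module of the least possible rank has its kernel in
    [m R^b]. *)
Lemma minimal_cover (m : submod R^o) (U : lmodType R) :
  (forall r, ~ m r -> exists u, u * r = 1) -> fin_gen U ->
  exists b (p : {linear 'rV[R]_b -> U}),
    (forall y, exists v, p v = y) /\ forall v, p v = 0 -> forall l, m (v 0 l).
Proof.
move=> unit_m fgU.
have ex : exists b, `[< exists p : {linear 'rV[R]_b -> U}, forall y, exists v, p v = y >].
  by have [b hb] := fin_gen_cover fgU; exists b; apply/asboolP.
case: (ex_minnP ex) => b /asboolP[p pS] bmin; exists b, p; split=> // v pv l.
apply: contrapT => /unit_m[u hu].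
(* A relation with a unit coefficient makes the generator [l] superfluous. *)
case: b => [|b] in p pS bmin v pv l hu *; first by case: l hu.
suff /asboolP/bmin : exists p : {linear 'rV[R]_b -> U}, forall y, exists v, p v = y.
  by rewrite ltnn.
have [h hh] : exists h : {linear 'rV[R]_b -> 'rV[R]_b.+1},
    forall r : 'rV[R]_b, h r = \row_i (if unlift l i is Some i' then r 0 i' else 0).
  apply: linear_exists => c r s; apply/rowP => i; rewrite !mxE.
  by case: unlift => [i'|]; rewrite ?mxE // mulr0 addr0.
exists (p \o h) => y; have [w <-] := pS y.
pose w' := w - (w 0 l * u) *: v.
exists (\row_i w' 0 (lift l i)).
have -> : p w = p w' by rewrite linearB linearZ /= pv scaler0 subr0.
rewrite /=; congr (p _); rewrite hh; apply/rowP => i; rewrite mxE.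
case: unliftP => [j ->|->]; first by rewrite mxE.
by rewrite !mxE -mulrA hu mulr1 subrr.
Qed.

Lemma free_cover (Z : lmodType R) : fin_gen Z ->
  exists b (K : lmodType R) (i : {linear K -> 'rV[R]_b}) (p : {linear 'rV[R]_b -> Z}),
    short_exact i p /\ fin_gen K.
Proof.
move=> /fin_gen_cover[b [p pS]]; have [i hi] := kernel_exact pS.
by exists b, (subquot (kernel_sub p) sub_zero), i, p; split=> //; apply/fin_gen_subquot/fin_gen_row.
Qed.

Lemma ext_zero_syzygy k b (K Z : lmodType R) (i : {linear K -> 'rV[R]_b})
    (p : {linear 'rV[R]_b -> Z}) :
  short_exact i p -> (ext_zero N k K <-> ext_zero N k.+1 Z).
Proof.
move=> h; split=> [hK|hZ].
  by apply: (ext_zero_right h hK); apply/ext_zero_projective/projective_row.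
by apply: (ext_zero_left h hZ); apply/ext_zero_projective/projective_row.
Qed.

(** [Z] is a [j]-th syzygy of [M], on which the first [j] terms of [x] are regular. *)
Lemma regular_syzygy (x : nat -> R) n (M : lmodType R) : wreg x R^o n -> fin_gen M ->
  forall j, (j <= n)%N -> exists Z : lmodType R,
    [/\ fin_gen Z, wreg x Z j & forall k, ext_zero N k Z <-> ext_zero N (k + j) M].
Proof.
move=> regR fgM; elim=> [|j IH] hj; first by exists M; split=> // k; rewrite addn0.
have [Z [fgZ hZ eZ]] := IH (ltnW hj).
have [b [K [i [p [hip fgK]]]]] := free_cover fgZ; exists K; split=> //.
  by apply: (wreg_left hip) => //; apply: wreg_row; apply: wreg_le regR.
by move=> k; rewrite (ext_zero_syzygy _ hip) eZ addSnnS.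
Qed.

End Syzygies.

(** Row vectors with all entries in the ideal [a]. *)
Section Rows.
Variables (R : comNzRingType) (b : nat).
Implicit Types a : submod R^o.
Fact rows_in0 a : forall l, a ((0 : 'rV[R]_b) 0 l).
Proof. by move=> l; rewrite mxE; apply: memsub0. Qed.
Fact rows_inP a r (u v : 'rV[R]_b) : (forall l, a (u 0 l)) -> (forall l, a (v 0 l)) ->
  forall l, a ((r *: u + v) 0 l).
Proof. by move=> hu hv l; rewrite !mxE; apply: (memsubP (V := R^o)). Qed.
Definition rows_in a : submod 'rV[R]_b := Submod (rows_in0 a) (@rows_inP a).

Lemma rows_split a a' (v : 'rV[R]_b) :
  (forall l, exists2 r, a r & a' (v 0 l - r)) ->
  exists2 u, rows_in a u & rows_in a' (v - u).
Proof.
move=> h; have /choice[f hf] : forall l, exists r, a r /\ a' (v 0 l - r).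
  by move=> l; have [r] := h l; exists r.
by exists (\row_l f l) => l; rewrite !mxE; case: (hf l).
Qed.

End Rows.

Lemma rows_in_map (R : comNzRingType) b c (a : submod R^o)
    (d : {linear 'rV[R]_b -> 'rV[R]_c}) v :
  rows_in b a v -> rows_in c a (d v).
Proof.
move=> hv l; rewrite [v]row_sum_delta linear_sum summxE.
apply: (memsub_sum (V := R^o)) => i _; rewrite linearZ mxE mulrC.
exact: (memsubZ (V := R^o)).
Qed.

(** * Maximal ideals that decompose modulo a regular sequence *)

(** The maximal ideal is [m = I + J] with [I /\ J = (x)], where [(x)] is generated
    by the first [n] terms of [x]: in [R / (x)] it is the direct sum of the images
    of [I] and [J]. *)
Record decomposition (R : comNzRingType) (x : nat -> R) (n : nat)
    (m I J : submod R^o) : Prop := Decomposition {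
  dec_unit : forall r, ~ m r -> exists u, u * r = 1;
  dec_proper : ~ m 1;
  dec_m : forall r, m r <-> exists2 a, I a & J (r - a);
  dec_x : forall r, xmul x R^o n r <-> I r /\ J r }.

Section Decomposition.
Variables (R : comNzRingType) (N : lmodType R).
Hypotheses (noethR : noetherian R) (fgN : fin_gen N).
Variables (x : nat -> R) (n : nat).
Hypothesis regR : wreg x R^o n.
Notation X := (xmul x R^o n).
Notation XR b := (xmul x 'rV[R]_b n).

Lemma decomposition_sym m I J : decomposition x n m I J -> decomposition x n m J I.
Proof.
case=> h1 h2 h3 h4; split=> // r; last by rewrite h4; split=> -[].
by rewrite h3; split=> -[a ha hb]; exists (r - a) => //; rewrite subKr.
Qed.

Lemma dec_Im m I J r : decomposition x n m I J -> I r -> m r.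
Proof. by move=> dec hr; apply/(dec_m dec); exists r; rewrite ?subrr //; apply: memsub0. Qed.

Lemma dec_xI m I J r : decomposition x n m I J -> X r -> I r.
Proof. by move=> dec /(dec_x dec)[]. Qed.

Lemma ext_zero_free_mod b k : (n <= k)%N ->
  ext_zero N k (subquot (sub_top : submod 'rV[R]_b) (XR b)).
Proof.
move=> hk; apply: (ext_zero_xmul (k0 := 0)) => //; first exact: wreg_row.
by move=> k' _; apply/ext_zero_projective/projective_row.
Qed.

(** The first syzygy [L / (x)] over [R / (x)] of a nonzero module killed by [J]
    has [J / (x)] as a direct summand: [J / (x)] embeds in the coordinate [0], and
    the vectors whose coordinate [0] is in [I] form a complement. *)
Lemma ext_zero_killed m I J (U : lmodType R) k :
  decomposition x n m I J -> (n <= k)%N -> fin_gen U ->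
  (forall r (u : U), J r -> (r : R) *: u = 0) -> (exists u : U, u <> 0) ->
  ext_zero N k.+1 U -> ext_zero N k (subquot J X).
Proof.
move=> dec hk fgU JU [u0 hu0] hU.
have [b [p [pS pm]]] := minimal_cover (dec_unit dec) fgU.
case: b => [|b] in p pS pm *.
  by have [v ev] := pS u0; case: hu0; rewrite -ev [v]thinmx0 linear0.
pose L := kernel_sub p.
have JL : forall v, rows_in b.+1 J v -> L v.
  move=> v hv /=; rewrite [v]row_sum_delta linear_sum big1 // => i _.
  by rewrite linearZ /= JU.
have XL v : XR b.+1 v -> L v.
  by move=> /xmul_row h; apply: JL => l; apply: (dec_xI (decomposition_sym dec)).
have [i [q [hiq _]]] := sq_ses XL (fun v (_ : L v) => Logic.I : mem_sub sub_top v).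
have hL : ext_zero N k (subquot L (XR b.+1)).
  apply: (ext_zero_left hiq); last exact: ext_zero_free_mod.
  apply/(ext_zero_sq N k.+1 (h := p) (E1 := sub_top) (E2 := sub_zero)) => //.
    by move=> w _; have [v hv] := pS w; exists v => //=; rewrite hv subrr.
  exact/ext_zero_top.
have [h hh] := scale_linear (delta_mx 0 0 : 'rV[R]_b.+1).
have [f hf] := coord_linear R (0 : 'I_b.+1).
have fh r : f (h r) = r by rewrite hf hh !mxE !eqxx mulr1.
apply: (ext_zero_sq_summand noethR (h := h) (E' := comap f I) _ _ _ _ _ _ hL).
- exact: fin_gen_row.
- move=> r hr; apply: JL => l; rewrite hh !mxE mulrC; exact: (memsubZ (V := R^o)).
- by move=> r _ hr; apply: xmul_map.
- by move=> v /(xmul_map f) hv; apply: (dec_xI dec hv).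
- move=> v /pm /(_ 0) /(dec_m (decomposition_sym dec))[r hr hr'].
  by exists r => //=; rewrite linearB /= fh hf.
- by move=> r hr /=; rewrite fh => hI; apply/(dec_x dec).
Qed.

Lemma fin_gen_ideal_mod (a b : submod R^o) : fin_gen (subquot a b).
Proof. by apply/fin_gen_subquot/fin_gen_regular. Qed.

(** The previous lemma for [U = I / (x)]. *)
Lemma ext_zero_swap m I J k : decomposition x n m I J -> (n <= k)%N ->
  (exists2 r, I r & ~ X r) ->
  ext_zero N k.+1 (subquot I X) -> ext_zero N k (subquot J X).
Proof.
move=> dec hk [r hr hr']; apply: (ext_zero_killed dec hk).
- exact: fin_gen_ideal_mod.
- move=> s q hs; have [v hv] := rep_ex q.
  apply/(rep0 (repZ (s : R) hv)); apply/(dec_x dec).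
  split; first exact/memsubZ/(rep_mem hv).
  by rewrite /= [s *: v]mulrC; apply: (memsubZ (V := R^o)).
- by exists (sq_mk X hr) => /(rep0 (rep_mk X hr)).
Qed.

(** If [Ext^i (J / (x), N) = 0] for [i >> 0], then [Ext^i (R/m, N) = 0] for
    [i > n + 1]. *)
Lemma ext_zero_field m I J : decomposition x n m I J ->
  (exists2 r, I r & ~ X r) -> (exists2 r, J r & ~ X r) ->
  (exists k0, forall k, (k0 <= k)%N -> ext_zero N k (subquot J X)) ->
  forall k, (n.+1 <= k)%N -> ext_zero N k (subquot (sub_top : submod R^o) m).
Proof.
move=> dec nI nJ [k0 hk0]; have dec' := decomposition_sym dec.
have down k d : (n <= k)%N ->
    ext_zero N (k + d) (subquot I X) /\ ext_zero N (k + d) (subquot J X) ->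
    ext_zero N k (subquot I X) /\ ext_zero N k (subquot J X).
  move=> hk; elim: d => [|d IH]; first by rewrite addn0.
  rewrite addnS => -[hI hJ]; apply: IH; split.
    by apply: (ext_zero_swap dec') => //; apply: leq_trans (leq_addr _ _).
  by apply: (ext_zero_swap dec) => //; apply: leq_trans (leq_addr _ _).
have both k : (n <= k)%N -> ext_zero N k (subquot I X) /\ ext_zero N k (subquot J X).
  move=> hk; apply: (down k k0) => //; split; last by apply/hk0/leq_addl.
  apply: (ext_zero_swap dec') => //; first by apply: leq_trans (leq_addr _ _).
  by apply: hk0; apply: leqW; apply: leq_addl.
case=> // k; rewrite ltnS => hk; have [hI hJ] := both k hk.
have xm r : X r -> m r by move=> /(dec_xI dec) /(dec_Im dec).
have [i [p [hip _]]] := sq_ses xm (fun r (_ : m r) => Logic.I : mem_sub sub_top r).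
apply: (ext_zero_right hip); last first.
  apply: (ext_zero_xmul (k0 := 0)) => //; last by apply: leqW.
  by move=> k' _; apply/ext_zero_projective/projective_regular.
have [||i' [p' [hip' _]]] := @sq_ses R R^o m I X.
- by move=> r /(dec_xI dec).
- by move=> r /(dec_Im dec).
apply: (ext_zero_mid hip' hI).
apply/(ext_zero_sq N k (h := idfun : {linear R^o -> R^o}) (D1 := J) (D2 := X)) => //.
- by move=> r /(dec_Im dec').
- by move=> r hr /=; rewrite (dec_x dec); split=> // -[].
- by move=> r /(dec_m dec')[a ha hb]; exists a.
Qed.

End Decomposition.

(** * Vanishing above degree [n + 1] *)

Section Bound.
Variables (R : comNzRingType) (N : lmodType R).
Hypotheses (noethR : noetherian R) (fgN : fin_gen N).
Variables (x : nat -> R) (n : nat).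
Hypothesis regR : wreg x R^o n.
Notation X := (xmul x R^o n).
Notation XR b := (xmul x 'rV[R]_b n).

(** [v] represents an element of the kernel of the map [(R/(x))^g -> (R/(x))^a]
    induced by [d], and has its entries in [m].  Then its [I]-part [u], and hence
    its [J]-part, also represents an element of the kernel: [d u] has its entries
    in [I], while [d v - d (v - u)] has its entries in [J]. *)
Lemma kernel_split m I J g a (d : {linear 'rV[R]_g -> 'rV[R]_a}) v :
  decomposition x n m I J -> XR a (d v) -> rows_in g m v ->
  exists2 u, rows_in g I u /\ XR a (d u) & rows_in g J (v - u).
Proof.
move=> dec dv mv; have dec' := decomposition_sym dec.
have [|u hu hu'] := @rows_split R g I J v; first by move=> l; apply/(dec_m dec)/mv.
exists u => //; split=> //; apply/xmul_row => l; apply/(dec_x dec); split.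
  exact: rows_in_map hu l.
rewrite -[u](subKr v) linearB; apply: (memsubB (D := rows_in a J)) l.
  by move=> l; apply: (dec_xI dec'); move/xmul_row: dv.
exact: rows_in_map.
Qed.

(** Here [comap d (XR a) / XR g] is the kernel of [(R/(x))^g -> (R/(x))^a].  Its
    [I]-part is a direct summand killed by [J]; if it is nonzero, then
    [ext_zero_killed] applies to it. *)
Lemma ext_zero_part m I J g a (d : {linear 'rV[R]_g -> 'rV[R]_a}) :
  decomposition x n m I J ->
  (exists2 r, I r & ~ X r) -> (exists2 r, J r & ~ X r) ->
  (forall v, XR a (d v) -> rows_in g m v) ->
  (exists k0, forall k, (k0 <= k)%N ->
     ext_zero N k (subquot (comap d (XR a)) (XR g))) ->
  (exists2 u, rows_in g I u /\ XR a (d u) & ~ XR g u) ->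
  forall k, (n.+1 <= k)%N -> ext_zero N k (subquot (sub_top : submod R^o) m).
Proof.
move=> dec nI nJ hm [k0 hk0] [u0 [Iu0 du0] nu0]; have dec' := decomposition_sym dec.
apply: (ext_zero_field noethR regR dec nI nJ); exists (maxn k0 n) => k.
rewrite geq_max => /andP[hk hkn].
pose U := sub_cap (rows_in g I) (comap d (XR a)).
apply: (ext_zero_killed noethR regR dec (U := subquot U (XR g)) hkn).
- exact/fin_gen_subquot/fin_gen_row.
- move=> r q hr; have [v hv] := rep_ex q; apply/(rep0 (repZ (r : R) hv)).
  apply/xmul_row => l; apply/(dec_x dec); rewrite mxE; split.
    by apply: (memsubZ (V := R^o)); case: (rep_mem hv).
  by rewrite mulrC; apply: (memsubZ (V := R^o)).
- have hU : U u0 by [].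
  by exists (sq_mk (XR g) hU) => /(rep0 (rep_mk (XR g) hU)).
apply: (ext_zero_sq_summand noethR (h := idfun : {linear 'rV[R]_g -> 'rV[R]_g})
          (E1 := comap d (XR a)) (E2 := XR g) (E' := rows_in g J)).
- exact: fin_gen_row.
- by move=> v [].
- by [].
- by move=> v /xmul_row hv l; apply: (dec_xI dec').
- by move=> v hv; have [u [? ?] ?] := kernel_split dec hv (hm _ hv); exists u.
- by move=> v [Iv _] Jv; apply/xmul_row => l; apply/(dec_x dec).
- by apply: hk0; apply: leqW.
Qed.

(** If [Ext^i (M, N) = 0] for [i >> 0], then [Ext^i (M, N) = 0] for
    [i > n + 1]. *)
Theorem ext_zero_bound m I J (M : lmodType R) :
  decomposition x n m I J ->
  (exists2 r, I r & ~ X r) -> (exists2 r, J r & ~ X r) -> fin_gen M ->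
  (exists k0, forall k, (k0 <= k)%N -> ext_zero N k M) ->
  forall k, (n.+1 <= k)%N -> ext_zero N k M.
Proof.
move=> dec nI nJ fgM [k0 hk0] k hk; have dec' := decomposition_sym dec.
have [Z [fgZ regZ eZ]] := regular_syzygy N noethR regR fgM (leqnn n).
have [a [Z1 [j [c [hjc fgZ1]]]]] := free_cover noethR fgZ.
have [g [p [pS pm]]] := minimal_cover (dec_unit dec) fgZ1.
have [i hip] := kernel_exact pS; set K := subquot _ _ in i hip.
have fgK : fin_gen K by apply/fin_gen_subquot/fin_gen_row.
have [iI _ pK] := hip.
have regF b : wreg x 'rV[R]_b n by apply: wreg_row.
have regZ1 : wreg x Z1 n by exact: wreg_left hjc (regF _) (wreg_le (leq_pred n) regZ).
have regK : wreg x K n by exact: wreg_left hip (regF _) (wreg_le (leq_pred n) regZ1).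
pose d : {linear 'rV[R]_g -> 'rV[R]_a} := j \o p.
(* [comap d (XR a) = K + XR g], since [(x) R^a] meets [Z1] in [(x) Z1]. *)
have dD v : XR a (d v) -> exists b, XR g (v - i b).
  move=> /(xmul_exact hjc regZ) /(xmul_lift pS)[v' hv' ev'].
  have /pK[b eb] : p (v - v') = 0 by rewrite linearB ev' subrr.
  by exists b; rewrite eb subKr.
have di b : d (i b) = 0 by rewrite /= (short_exact0 hip) linear0.
have dm v : XR a (d v) -> rows_in g m v.
  move=> /dD[b /xmul_row hb] l; rewrite -[v](subrK (i b)) mxE.
  apply: (memsubD (V := R^o)); first exact/(dec_Im dec)/(dec_xI dec).
  by apply: pm; apply: (short_exact0 hip).
have eK k' : ext_zero N k' K <-> ext_zero N (k' + n).+2 M.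
  by rewrite (ext_zero_syzygy _ _ hip) (ext_zero_syzygy _ _ hjc) eZ.
have hD : exists k1, forall k', (k1 <= k')%N -> ext_zero N k' (subquot (comap d (XR a)) (XR g)).
  exists (k0 + n)%N => k' hk'.
  apply/(ext_zero_sq N k' (h := i) (D1 := sub_top) (D2 := xmul x K n)).
  - by move=> b _; rewrite /= (short_exact0 hip) linear0; apply: memsub0.
  - by move=> b _; split=> [|h]; [apply: (xmul_exact hip regZ1) | apply: xmul_map].
  - by move=> v /dD[b hb]; exists b.
  - apply: ext_zero_xmul regK _ k' hk' => k2 hk2; apply/eK/hk0.
    by rewrite -addnS -addnS; apply: leq_trans hk2 (leq_addr _ _).
have [hX|] := pselect (forall v, XR a (d v) -> XR g v); last first.
  move=> /existsNP[v /not_implyP[dv nv]].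
  apply: (ext_zero_residue noethR fgN (dec_unit dec) (dec_proper dec) _ fgM hk) => k1.
  have [u [Iu du] Ju] := kernel_split dec dv (dm v dv).
  have [hu|hu] := pselect (XR g u); last by apply: (ext_zero_part dec nI nJ dm hD); exists u.
  apply: (ext_zero_part dec' nJ nI dm hD); exists (v - u); first split=> //.
    by rewrite linearB; apply: memsubB.
  by move=> h; apply: nv; rewrite -[v](subrK u); apply: memsubD.
(* Now [K = (x) K], hence [K = 0] and the first syzygy of [Z] is free. *)
have K0 : forall b : K, b = 0.
  apply: (xmul_zero (x := x) (j := n) _ fgK) => [l hl|b].
    apply: (jacobson_unit (dec_unit dec) (dec_proper dec)).
    apply/(dec_Im dec)/(dec_xI dec).
    exact: xmul_mem.
  by apply: (xmul_exact hip regZ1); apply: hX; rewrite di; apply: memsub0.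
have pI : injective p by apply: linear_inj0 => v /pK[b <-]; rewrite (K0 b) linear0.
have eZ1 k' : ext_zero N k' Z1.
  by apply: (ext_zero_iso pS pI); apply/ext_zero_projective/projective_row.
have := eZ1 (k - n.+1)%N; rewrite (ext_zero_syzygy _ _ hjc) eZ.
by rewrite addSnnS subnK.
Qed.

End Bound.

(** * The decomposition attached to a quasi-fiber product ring *)

Local Open Scope quotient_scope.

Section LocalRings.
Variable R : comNzRingType.

Lemma submod_ideal (a : submod R^o) : is_ideal (R := R) a.
Proof.
split; [exact: memsub0 | by move=> r s; apply: (memsubD (V := R^o))
  | by move=> r s; apply: (memsubZ (V := R^o))].
Qed.

Lemma ideal_submod (I : R -> Prop) : is_ideal I -> exists a : submod R^o, forall r, a r <-> I r.
Proof.
move=> [I0 ID IM].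
have IP (r u v : R^o) : I u -> I v -> I (r *: u + v) by move=> hu hv; apply: ID => //; apply: IM.
by exists (@Submod R R^o I I0 IP).
Qed.

Lemma maximal_ideal_exists : noetherian R -> forall a : submod R^o, ~ a 1 ->
  exists2 m : R -> Prop, maximal_ideal m & forall r, a r -> m r.
Proof.
move=> noethR; apply: (noetherian_ideal_ind noethR) => a IH a1.
have [amax|namax] := pselect (maximal_ideal (R := R) a); first by exists (a : R -> Prop).
have : exists b : submod R^o, [/\ ~ b 1, forall r, a r -> b r & exists2 r, b r & ~ a r].
  apply: contrapT => nb; apply: namax; split=> //; first exact: submod_ideal.
  move=> J /ideal_submod[b hb] J1 aJ r Jr; apply: contrapT => nar; apply: nb.
  by exists b; split; [rewrite hb | move=> s /aJ/hb | exists r => //; apply/hb].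
move=> [b [b1 ab hb]]; have [m hm bm] := IH b ab hb b1.
by exists m => // r /ab/bm.
Qed.

(** In a local ring, the elements outside a maximal ideal [m] are units. *)
Lemma local_unit (m : submod R^o) : local_ring R -> ~ m 1 ->
  (forall r, ~ m r -> exists u : R, m (1 - u * r)) ->
  forall r, ~ m r -> exists u : R, u * r = 1.
Proof.
move=> [noethR [m0 _ m0u]] m1 hm r nmr; apply: contrapT => nu.
have mmax : maximal_ideal (R := R) m.
  split=> //; first exact: submod_ideal.
  move=> J [J0 JD JM] J1 mJ s Js; apply: contrapT => /hm[u /mJ hu]; apply: J1.
  by rewrite -[1](subrK (u * s)); apply: JD => //; apply: JM.
have [|m' m'max rm'] := maximal_ideal_exists noethR (a := sub_adj sub_zero (r : R^o)).
  by move=> [u /eqP]; rewrite subr_eq0 => /eqP e; apply: nu; exists u.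
apply: nmr; apply/(m0u _ mmax)/(m0u _ m'max)/rm'; exact: sub_adj_gen.
Qed.

End LocalRings.

Section QuasiFiber.
Variables (R : comNzRingType).

(** For [R / (x)] isomorphic to the fiber product of [S] and [T] over [k], the ideals
    [m], [I] and [J] are the kernels of [R -> k], [R -> T] and [R -> S]. *)
Lemma quasi_fiber_decomposition (xs : seq R) :
  quasi_fiber_product_ring xs ->
  exists m I J : submod R^o, let X := xmul (nth 0 xs) R^o (size xs) in
    [/\ decomposition (nth 0 xs) (size xs) m I J,
        exists2 r, I r & ~ X r & exists2 r, J r & ~ X r].
Proof.
move=> [locR _ [I0 hI0 [S [T [k [pS [pT [_ [pSs pTs] [niS niT] [f [g fK gK]]]]]]]]]].
pose q1 : {rmorphism R -> S} := fst \o val \o f \o \pi_({ideal_quot I0}).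
pose q2 : {rmorphism R -> T} := snd \o val \o f \o \pi_({ideal_quot I0}).
have q12 r : pS (q1 r) = pT (q2 r) by apply/eqP; apply: (valP (f (\pi r))).
have qS s t : pS s = pT t -> exists r, q1 r = s /\ q2 r = t.
  move=> e; have he : fiber_pred pS pT (s, t) by apply/eqP.
  exists (repr (g (Sub (s, t) he))).
  by rewrite /q1 /q2 /= !reprK !gK SubK.
have qK r : xmul (nth 0 xs) R^o (size xs) r <-> q1 r = 0 /\ q2 r = 0.
  rewrite (xmul_ideal _ (xs := xs)) // take_size -hI0; split=> [hr|[e1 e2]].
    have e : \pi_({ideal_quot I0}) r = 0.
      apply/eqP; rewrite -(rmorph0 \pi_({ideal_quot I0})).
      by rewrite -Quotient.idealrBE subr0.
    by rewrite /q1 /q2 /= e !rmorph0.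
  have e : f (\pi r) = 0.
    by apply: val_inj; rewrite [LHS]surjective_pairing; congr pair.
  rewrite -[r]subr0 Quotient.idealrBE; apply/eqP.
  by rewrite [RHS]rmorph0; apply: (can_inj fK); rewrite e rmorph0.
clearbody q1 q2.
have kernel_nonzero (A : comNzRingType) (p : {rmorphism A -> k}) :
    ~ injective p -> exists2 s, p s = 0 & s <> 0.
  move=> np; apply: contrapT => h; apply: np => s t e.
  apply/eqP; rewrite -subr_eq0; apply/eqP; apply: contrapT => hst; apply: h.
  by exists (s - t); rewrite ?rmorphB ?e ?subrr.
have mP (r u v : R^o) : pS (q1 u) = 0 -> pS (q1 v) = 0 -> pS (q1 (r *: u + v)) = 0.
  by move=> hu hv; rewrite !rmorphD !rmorphM /= hu hv mulr0 addr0.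
have IP (r u v : R^o) : q2 u = 0 -> q2 v = 0 -> q2 (r *: u + v) = 0.
  by move=> hu hv; rewrite rmorphD rmorphM hu hv mulr0 addr0.
have JP (r u v : R^o) : q1 u = 0 -> q1 v = 0 -> q1 (r *: u + v) = 0.
  by move=> hu hv; rewrite rmorphD rmorphM hu hv mulr0 addr0.
have m0 : pS (q1 (0 : R^o)) = 0 by rewrite !rmorph0.
pose m := @Submod R R^o (fun r => pS (q1 r) = 0) m0 mP.
exists m,
  (@Submod R R^o (fun r => q2 r = 0) (rmorph0 q2) IP),
  (@Submod R R^o (fun r => q1 r = 0) (rmorph0 q1) JP) => X.
have m1 : ~ m 1 by rewrite /= !rmorph1; apply/eqP/oner_neq0.
split; first split.
- apply: (local_unit (m := m) locR m1) => r /= /eqP nr.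
  have [s hs] := pSs (pS (q1 r))^-1; have [t ht] := pTs (pS (q1 r))^-1.
  have [|u [hu _]] := qS s t; first by rewrite hs ht.
  exists u; rewrite /m /= (rmorphB q1) (rmorph1 q1) (rmorphM q1) hu.
  by rewrite rmorphB rmorph1 rmorphM hs mulVf // subrr.
- exact: m1.
- move=> r /=; split=> [hr|[a ha hb]].
    have [|a [h1 h2]] := qS (q1 r) 0; first by rewrite hr rmorph0.
    by exists a; rewrite ?rmorphB ?h1 ?subrr.
  by rewrite -[r](subrK a) rmorphD hb add0r q12 ha rmorph0.
- by move=> r; rewrite qK /=; split=> -[].
- have [s hs ns] := kernel_nonzero _ _ niS.
  have [|r [h1 h2]] := qS s 0; first by rewrite hs rmorph0.
  by exists r => //; rewrite qK h1 => -[].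
- have [t ht nt] := kernel_nonzero _ _ niT.
  have [|r [h1 h2]] := qS 0 t; first by rewrite ht rmorph0.
  by exists r => //; rewrite qK h2 => -[].
Qed.

Lemma regular_sequence_wreg (xs : seq R) :
  regular_sequence xs -> wreg (nth 0 xs) R^o (size xs).
Proof.
move=> [h _] i hi r hr.
apply/(xmul_ideal (xs := xs) r (fun _ _ => erefl) (ltnW hi)).
by apply: h => //; apply/(xmul_ideal (xs := xs) _ (fun _ _ => erefl) (ltnW hi)).
Qed.

(** * The Ext-index *)

Lemma quasi_fiber_Ext_bound (xs : seq R) :
  quasi_fiber_product_ring xs -> uniform_Ext_bound R (size xs + 2).
Proof.
move=> hR; have [[noethR _] /regular_sequence_wreg regR _] := hR.
have [m [I [J [dec nI nJ]]]] := quasi_fiber_decomposition hR.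
move=> M N fgM fgN [i0 hi0] [|i]; first by rewrite addn2.
rewrite addn2 ltnS => hi; apply/ext_zeroP => //.
apply: (ext_zero_bound noethR fgN regR dec nI nJ fgM _ hi).
by exists i0 => k hk; apply/ext_zeroP => //; apply: hi0; apply: leqW.
Qed.

End QuasiFiber.

Lemma Ext_index_exists (R : comNzRingType) b :
  uniform_Ext_bound R b -> exists2 c, is_Ext_index R c & (c <= b)%N.
Proof.
move=> hb; have ex : exists c, `[< uniform_Ext_bound R c >] by exists b; apply/asboolP.
case: (ex_minnP ex) => c /asboolP hc cmin; exists c; last exact/cmin/asboolP.
by split=> // c' hc'; apply/cmin/asboolP.
Qed.

Theorem theorem3p3 (R : comNzRingType) (n : nat) (x : n.-tuple R)
    (hR : quasi_fiber_product_ring x) :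
  (exists2 b : nat, is_Ext_index R b & (b <= n + 2)%N) /\
  UAC R /\
  (Gorenstein R -> AB_ring R).
Proof.
have := quasi_fiber_Ext_bound hR; rewrite size_tuple => hb.
have hU : UAC R by exists (n + 2)%N.
by split; [exact: Ext_index_exists hb | split].
Qed.
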